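(* Suppose $n_Q=0$, i.e. only the $P$-sample of size $n_P$ is available. Let $\theta=\{\alpha,\beta_P,\beta_Q,\gamma,c_\lambda,r_\lambda,C_\beta,C_\alpha,C_\gamma\}$ be fixed, and let $\Pi(\theta)$ and $\mathcal{R}_Q$ be as defined in the context. Then there is a constant $c>0$ depending on $\theta$ such that: (a) If $\beta_P>\gamma\beta_Q$ and $\alpha\beta_P\le\gamma d$, then $\inf_{\widehat f}\sup_{(P,Q)\in\Pi(\theta)}\mathcal{R}_Q(\widehat f)\ge c\,n_P^{-\frac{(1+\alpha)\beta_P}{\gamma(2\beta_P+d)}}$. (b) If $\beta_P\le\gamma\beta_Q$ and $\alpha\beta_Q\le d$, then $\inf_{\widehat f}\sup_{(P,Q)\in\Pi(\theta)}\mathcal{R}_Q(\widehat f)\ge c\,n_P^{-\frac{(1+\alpha)\beta_Q}{2\gamma\beta_Q+d}}$. Here the infimum is taken over all classifiers $\widehat f$ constructed on the $P$-data $(\mathbf{X}_1^P,Y_1^P),\dots,(\mathbf{X}_{n_P}^P,Y_{n_P}^P)$.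
   Context: Notation. $d\ge1$ is a fixed dimension, $\|\cdot\|$ is the Euclidean norm, $B(\mathbf{x},r)$ is the Euclidean ball of radius $r$ centered at $\mathbf{x}$, $\lambda$ is Lebesgue measure on $\mathbb{R}^d$. Model. $P,Q$ are probability distributions on $[0,1]^d\times\{0,1\}$; a draw is written $(\mathbf{X},Y)$. $P_{\mathbf{X}},Q_{\mathbf{X}}$ are the marginal distributions of $\mathbf{X}$, and $\eta_P(\mathbf{x})=P(Y=1|\mathbf{X}=\mathbf{x})$, $\eta_Q(\mathbf{x})=Q(Y=1|\mathbf{X}=\mathbf{x})$. The data are $n_P$ i.i.d. observations $(\mathbf{X}_i^P,Y_i^P)$, $1\le i\le n_P$, from $P$ (there are no observations from $Q$). Class $\Pi(\theta)$. For $\theta=\{\alpha,\beta_P,\beta_Q,\gamma,c_\lambda,r_\lambda,C_\beta,C_\alpha,C_\gamma\}$ with $\alpha\ge0$, $\beta_P,\beta_Q\in[0,1]$, $\max(\beta_P,\beta_Q)>0$, and $\gamma,c_\lambda,r_\lambda,C_\beta,C_\alpha,C_\gamma>0$, $\Pi(\theta)$ is the set of all pairs $(P,Q)$ satisfying, for some $\Omega\subset[0,1]^d$: (i) (common support and strong density) $\Omega$ is the common support of $P_{\mathbf{X}}$ and $Q_{\mathbf{X}}$; $\lambda[\Omega\cap B(\mathbf{x},r)]\ge c_\lambda\lambda[B(\mathbf{x},r)]$ for all $0<r<r_\lambda$ and $\mathbf{x}\in\Omega$; and $c_\lambda<\frac{dP_{\mathbf{X}}}{d\lambda}(\mathbf{x})<c_\lambda^{-1}$,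 $c_\lambda<\frac{dQ_{\mathbf{X}}}{d\lambda}(\mathbf{x})<c_\lambda^{-1}$ for all $\mathbf{x}\in\Omega$. (ii) (Hölder smoothness) $|\eta_P(\mathbf{x}_1)-\eta_P(\mathbf{x}_2)|\le C_\beta\|\mathbf{x}_1-\mathbf{x}_2\|^{\beta_P}$ and $|\eta_Q(\mathbf{x}_1)-\eta_Q(\mathbf{x}_2)|\le C_\beta\|\mathbf{x}_1-\mathbf{x}_2\|^{\beta_Q}$ for all $\mathbf{x}_1,\mathbf{x}_2\in\Omega$. (iii) (Tsybakov noise) $Q_{\mathbf{X}}(|\eta_Q(\mathbf{X})-1/2|<t)\le C_\alpha t^\alpha$ for all $t\in(0,1/2]$. (iv) (relative signal exponent) for all $\mathbf{x}\in\Omega$, $(\eta_P(\mathbf{x})-1/2)(\eta_Q(\mathbf{x})-1/2)\ge0$ and $|\eta_P(\mathbf{x})-1/2|\ge C_\gamma|\eta_Q(\mathbf{x})-1/2|^\gamma$. Excess risk. For a classifier $f$ with values in $\{0,1\}$, $\mathcal{E}_Q(f)=Q(f(\mathbf{X})\ne Y)$. Let $f_Q^*(\cdot)=\mathbb{I}(\eta_Q(\cdot)\ge1/2)$. For a data-dependent classifier $\widehat f$, $\mathcal{R}_Q(\widehat f)=\mathbb{E}(\mathcal{E}_Q(\widehat f))-\mathcal{E}_Q(f_Q^* )$, the expectation being over the training data.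
   Formalization: The bound is proved for c_λ at most a threshold depending on d, r_λ, and C_α at least a threshold depending on d and the parameters of θ other than c_λ, C_α; for arbitrary θ it is false (e.g. Π(θ) is empty if c_λ ≥ 1). *)

(* Defs.v *)
From HB Require Import structures.
From mathcomp Require Import all_boot all_order all_algebra.
From mathcomp Require Import all_classical all_reals all_analysis.

Set Implicit Arguments.
Unset Strict Implicit.
Unset Printing Implicit Defensive.

Import Order.TTheory GRing.Theory Num.Theory.
Import numFieldNormedType.Exports.

Local Open Scope classical_set_scope.
Local Open Scope ring_scope.

Definition cons_pair (T : Type) n (z : T * n.-tuple T) : n.+1.-tuple T :=
  [the n.+1.-tuple T of z.1 :: z.2].

Definition uncons_pair (T : Type) n (t : n.+1.-tuple T) : T * n.-tuple T :=
  (thead t, [tuple of behead t]).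

Lemma cons_pairK (T : Type) n : cancel (@cons_pair T n) (@uncons_pair T n).
Proof.
by case=> x t; congr pair; exact/val_inj.
Qed.

Section cons_measure.
Local Open Scope ereal_scope.
Context (disp : measure_display) (T : measurableType disp) (R : realType).
Context (mu : {sigma_finite_measure set T -> \bar R}) (n : nat).
Context (nu : {sigma_finite_measure set (n.-tuple T) -> \bar R}).

Lemma measurable_cons_pair : measurable_fun setT (@cons_pair T n).
Proof. exact: measurable_cons measurable_fst measurable_snd. Qed.

Lemma measurable_uncons_pair : measurable_fun setT (@uncons_pair T n).
Proof.
by apply: measurable_fun_pair; [exact: measurable_tnth | exact: measurable_behead].
Qed.

Definition cons_measure := pushforward (mu \x nu) (@cons_pair T n).

Let mcons := measurable_cons_pair.

Let cons_measure0 : cons_measure set0 = 0.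
Proof. by rewrite /cons_measure /pushforward preimage_set0 measure0. Qed.

Let cons_measure_ge0 A : 0 <= cons_measure A.
Proof. exact: measure_ge0. Qed.

Let cons_measure_sigma_additive : semi_sigma_additive cons_measure.
Proof.
exact: (@measure_semi_sigma_additive _ _ _
  (measure_function_pushforward__canonical__measure_function_Measure
    (mu \x nu) mcons)).
Qed.

HB.instance Definition _ := isMeasure.Build _ _ _ cons_measure
  cons_measure0 cons_measure_ge0 cons_measure_sigma_additive.

Let cons_measure_sigma_finite : sigma_finite setT cons_measure.
Proof.
have /sigma_finiteP[F [FT ndF Foo]] := sigma_finiteT mu.
have /sigma_finiteP[G [GT ndG Goo]] := sigma_finiteT nu.
exists (fun k => @uncons_pair T n @^-1` (F k `*` G k)).
  rewrite -preimage_bigcup (_ : \bigcup_k _ = setT) ?preimage_setT//.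
  rewrite -setXTT FT GT predeqE => -[x y]; split.
    by move=> [k _ [? ?]]; split; exists k.
  move=> [/= [i _ Fx] [j _ Gy]]; exists (maxn i j) => //; split.
  - by move: x Fx; exact/subsetPset/ndF/leq_maxl.
  - by move: y Gy; exact/subsetPset/ndG/leq_maxr.
move=> k; have [? ?] := Foo k; have [? ?] := Goo k; split.
  rewrite -[X in measurable X]setTI.
  by apply: measurable_uncons_pair => //; exact: measurableX.
rewrite /cons_measure /pushforward -comp_preimage.
rewrite (_ : _ \o _ = id) ?preimage_id; last exact/funext/cons_pairK.
by rewrite product_measure1E// lte_mul_pinfty// ge0_fin_numE.
Qed.

HB.instance Definition _ :=
  Measure_isSigmaFinite.Build _ _ _ cons_measure cons_measure_sigma_finite.

End cons_measure.

Section tuple_measure.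
Local Open Scope ereal_scope.
Context (disp : measure_display) (T : measurableType disp) (R : realType).
Implicit Types mu : {sigma_finite_measure set T -> \bar R}.

(* The n-fold product of mu with itself. *)
Fixpoint tuple_measure mu n : {sigma_finite_measure set (n.-tuple T) -> \bar R} :=
  if n is n'.+1 then cons_measure mu (tuple_measure mu n')
  else \d_([tuple] : 0.-tuple T).

Lemma tuple_measureE mu n (A : 'I_n -> set T) :
  (forall i, measurable (A i)) ->
  tuple_measure mu n [set t | forall i, A i (tnth t i)] = \prod_(i < n) mu (A i).
Proof.
elim: n A => [|n IH] A mA.
  rewrite big_ord0 /= diracE mem_set//= => -[]//.
rewrite big_ord_recl -IH; last by move=> i; exact: mA.
rewrite /= /cons_measure /pushforward -product_measure1E//.
  congr (_ _); apply/seteqP; split=> -[x t] /=.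
    move=> h; split; first exact: (h ord0).
    by move=> i; have := h (lift ord0 i); rewrite tnthS.
  move=> [h0 h] i; case: (unliftP ord0 i) => [j|] -> //.
  by rewrite tnthS; exact: h.
rewrite (_ : [set _ | _] =
    \bigcap_(i in [set: 'I_n]) ((@tnth n T ^~ i) @^-1` A (lift ord0 i))).
  apply: fin_bigcap_measurable; first exact: finite_finset.
  by move=> i _; rewrite -[X in measurable X]setTI; exact: measurable_tnth.
by apply/seteqP; split=> t /= h i; [move=> _|]; exact: h.
Qed.

End tuple_measure.

(* R^d with the product sigma-algebra of the Borel sets; measurableTypeR R is R
   with the measurable structure on which lebesgue_measure is defined. *)
Notation euclidean R d := (d.-tuple (measurableTypeR R)).

Section euclidean_space.
Context (R : realType) (d : nat).
Implicit Types (x y : euclidean R d).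

Definition edist x y : R :=
  Num.sqrt (\sum_(i < d) ((tnth x i : R) - tnth y i) ^+ 2).

Definition eball x (r : R) : set (euclidean R d) := [set y | edist x y < r].

Definition unit_cube : set (euclidean R d) :=
  [set x | forall i, 0 <= (tnth x i : R) <= 1].

Definition lebesgue : {sigma_finite_measure set (euclidean R d) -> \bar R} :=
  tuple_measure (@lebesgue_measure R) d.

Definition support (mu : set (euclidean R d) -> \bar R) : set (euclidean R d) :=
  [set x | forall r : R, 0 < r -> (0 < mu (eball x r))%E].

Definition is_density (mu : set (euclidean R d) -> \bar R) (p : euclidean R d -> R) :=
  [/\ measurable_fun setT p, forall x, 0 <= p x &
      forall A, measurable A -> mu A = (\int[lebesgue]_(x in A) (p x)%:E)%E].

End euclidean_space.
Arguments lebesgue {R d}.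
Arguments unit_cube {R d}.

Section classification.
Context (R : realType) (d : nat).
Local Notation joint := (probability (euclidean R d * bool)%type R).

Definition marginal (P : joint) : set (euclidean R d) -> \bar R := pushforward P fst.

(* eta is a version of the conditional probability x |-> P(Y = 1 | X = x). *)
Definition is_regression (P : joint) (eta : euclidean R d -> R) :=
  [/\ measurable_fun setT eta, forall x, 0 <= eta x <= 1 &
      forall A, measurable A ->
        P (A `*` [set true]) = (\int[marginal P]_(x in A) (eta x)%:E)%E].

(* The regression function is only determined up to a null set of the marginal,
   whereas the assumptions below are pointwise: a distribution comes with the
   version they refer to. *)
Record law := Law {
  law_prob :> joint;
  law_cube : law_prob (unit_cube `*` setT) = 1%E;
  regression : euclidean R d -> R;
  regressionP : is_regression law_prob regression }.

Record params := Params {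
  alpha : R; beta_P : R; beta_Q : R; gamma : R;
  c_lambda : R; r_lambda : R; C_beta : R; C_alpha : R; C_gamma : R }.

Definition valid_params (theta : params) :=
  [/\ 0 <= alpha theta, 0 <= beta_P theta <= 1, 0 <= beta_Q theta <= 1 &
      0 < Num.max (beta_P theta) (beta_Q theta)] /\
  [/\ 0 < gamma theta, 0 < c_lambda theta & 0 < r_lambda theta] /\
  [/\ 0 < C_beta theta, 0 < C_alpha theta & 0 < C_gamma theta].

Definition regular_set (c r0 : R) (Omega : set (euclidean R d)) :=
  forall x r, Omega x -> 0 < r < r0 ->
    (c%:E * lebesgue (eball x r) <= lebesgue (Omega `&` eball x r))%E.

Definition strong_density (c : R) (Omega : set (euclidean R d))
    (P : joint) :=
  exists2 p, is_density (marginal P) p & forall x, Omega x -> c < p x < c^-1.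

(* In MathComp-Analysis, 0 `^ 0 = 1. *)
Definition holder (C beta : R) (Omega : set (euclidean R d))
    (eta : euclidean R d -> R) :=
  forall x y, Omega x -> Omega y ->
    `|eta x - eta y| <= C * edist x y `^ beta.

Definition tsybakov_noise (C a : R) (Q : law) :=
  forall t : R, 0 < t <= 2^-1 ->
    (marginal Q [set x | `|regression Q x - 2^-1| < t]%R <= (C * t `^ a)%:E)%E.

Definition relative_signal (C g : R) (Omega : set (euclidean R d))
    (etaP etaQ : euclidean R d -> R) :=
  forall x, Omega x ->
    0 <= (etaP x - 2^-1) * (etaQ x - 2^-1) /\
    C * `|etaQ x - 2^-1| `^ g <= `|etaP x - 2^-1|.

Definition transfer_class (theta : params) : set (law * law) :=
  [set PQ : law * law | exists Omega : set (euclidean R d),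
    let: (P, Q) := PQ in
    [/\ [/\ Omega `<=` unit_cube,
            Omega = support (marginal P) & Omega = support (marginal Q)],
        [/\ regular_set (c_lambda theta) (r_lambda theta) Omega,
            strong_density (c_lambda theta) Omega P &
            strong_density (c_lambda theta) Omega Q],
        holder (C_beta theta) (beta_P theta) Omega (regression P) /\
        holder (C_beta theta) (beta_Q theta) Omega (regression Q),
        tsybakov_noise (C_alpha theta) (alpha theta) Q &
        relative_signal (C_gamma theta) (gamma theta) Omega
          (regression P) (regression Q)]].

Definition risk (P : joint) (f : euclidean R d -> bool) : \bar R :=
  P [set z | f z.1 != z.2].

Definition bayes (Q : law) : euclidean R d -> bool :=
  fun x => 2^-1 <= regression Q x.

Definition sample n := n.-tuple (euclidean R d * bool)%type.

(* Measurability in the sample and the feature jointly makes the conditional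
   risk of the trained classifier a measurable function of the sample. *)
Definition data_classifier n : set (sample n -> euclidean R d -> bool) :=
  [set fhat | measurable_fun setT
                (fun z : sample n * euclidean R d => fhat z.1 z.2)].

Definition excess_risk n (P Q : law) (fhat : sample n -> euclidean R d -> bool)
    : \bar R :=
  (\int[tuple_measure P n]_s risk Q (fhat s) - risk Q (bayes Q))%E.

Definition minimax_excess_risk n (theta : params) : \bar R :=
  ereal_inf [set ereal_sup [set excess_risk PQ.1 PQ.2 fhat |
                             PQ in transfer_class theta] |
             fhat in @data_classifier n].

End classification.
Arguments minimax_excess_risk {R} d n theta.

(* Main.v *)
From HB Require Import structures.
From Pilot Require Import Defs.
From mathcomp Require Import all_boot all_order all_algebra.
From mathcomp Require Import all_classical all_reals all_analysis.
From mathcomp Require Import measurable_realfun ring lra.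

(* The lower bound is Assouad's lemma for a family of pairs (P_sigma, Q_sigma)
   indexed by signs sigma on a grid of M^d cells of side s, all with the uniform
   distribution on the same domain as marginal. On a cell, eta_P and eta_Q are
   1/2 + sigma cp s^(g e) and 1/2 + sigma cq s^e, with e = max(bP / g, bQ). The
   cells fill a corner of size 2 M s of the unit cube, and the rest of the domain
   is the part of the cube where the sup-norm |x| is at least 4 M s. There
   eta_P = 1/2 + cp |x|^(g e) and eta_Q = 1/2 + cq |x|^e do not depend on sigma:
   they leave 1/2 slowly enough to be Hoelder up to the cells, and fast enough
   for the noise condition. Having this mass next to the cells makes the domain
   regular at every scale. With s ~ n^(-1/(2 g e + d)) a single sign cannot be
   detected from n observations of P, and M^d ~ s^(a e - d) is the largest number
   of cells compatible with the noise condition; the excess risk is then of order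
   M^d s^d s^e = s^((1 + a) e). *)

Set Implicit Arguments.
Unset Strict Implicit.
Unset Printing Implicit Defensive.

Import Order.TTheory GRing.Theory Num.Theory.
Import numFieldNormedType.Exports.
(* all_analysis has another [edist]. *)
Import Pilot.Defs.

Local Open Scope classical_set_scope.
Local Open Scope ring_scope.

(** * Integration *)

(** At scale s, smoothness lets eta_Q move by about s^bQ and eta_P by s^bP, while the relative
    signal forces eta_P to move by at least the g-th power of the move of eta_Q. So eta_Q moves by
    at most min(s^bQ, s^(bP/g)) = s^e: this is the origin of e. Giving eta_P only s^(g e), the least
    that the relative signal allows, makes the sample as uninformative as possible. The two parts of
    the theorem are the two values of the maximum, and the side condition of each reads a e <= d.

    Smoothness is required on the domain only. Hence no bump functions: the regression functions are
    constant on cells separated by gaps of length s. The price is paid in geometry: a domain full of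
    gaps must be closed, to be a support, and must fill a fixed proportion of every ball centred in
    it, at scales below s, between s and M s, and above M s. Its pieces are products or contain
    large cubes, so that this reduces to estimates on the line. *)

Section mdensity.
Local Open Scope ereal_scope.
Context d (T : measurableType d) (R : realType).
Variables (mu : {measure set T -> \bar R}) (f : T -> R).
Hypotheses (mf : measurable_fun setT f) (f0 : forall x, (0 <= f x)%R).

(** The two proofs are arguments so that the measure structure can be attached to the term
    itself. *)
Definition mdensity of measurable_fun setT f & (forall x, (0 <= f x)%R) :=
  fun A : set T => \int[mu]_(x in A) (f x)%:E.

Local Notation nu := (mdensity mf f0).

Let mdensity0 : nu set0 = 0.
Proof. exact: integral_set0. Qed.

Let mdensity_ge0 A : 0 <= nu A.
Proof. by apply: integral_ge0 => x _; rewrite lee_fin. Qed.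

Let mEf D : measurable_fun D (fun x => (f x)%:E).
Proof. exact/measurable_funTS/measurable_EFinP. Qed.

Let mdensity_sigma_additive : semi_sigma_additive nu.
Proof.
move=> F mF tF mUF; rewrite /mdensity ge0_integral_bigcup//.
- by apply: is_cvg_nneseries => n _ _; exact: mdensity_ge0.
- by move=> x _; rewrite lee_fin.
Qed.

HB.instance Definition _ := isMeasure.Build _ _ _ nu
  mdensity0 mdensity_ge0 mdensity_sigma_additive.

Let integral_indic_mdensity E : measurable E ->
  \int[nu]_x (\1_E x)%:E = \int[mu]_x ((\1_E x)%:E * (f x)%:E).
Proof.
move=> mE; rewrite integral_indic// setIT [LHS]integral_mkcond.
apply: eq_integral => x _; rewrite restrict_EFin -EFinM; congr EFin.
by rewrite patchE indicE; case: ifPn; rewrite ?mul1r ?mul0r.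
Qed.

Import HBNNSimple.

Let integral_nnsfun_mdensity (h : {nnsfun T >-> R}) :
  \int[nu]_x (h x)%:E = \int[mu]_x ((h x)%:E * (f x)%:E).
Proof.
under [LHS]eq_integral do rewrite fimfunE -fsumEFin//.
rewrite [LHS]ge0_integral_fsum//; last 2 first.
  - by move=> r; exact/measurable_EFinP/measurableT_comp.
  - by move=> n x _; rewrite EFinM nnfun_muleindic_ge0.
under [RHS]eq_integral.
  move=> x xD; rewrite fimfunE -fsumEFin// muleC ge0_mule_fsumr; last first.
    by move=> r; rewrite EFinM nnfun_muleindic_ge0.
  over.
rewrite [RHS]ge0_integral_fsum//; last 2 first.
  - move=> r; apply/emeasurable_funM => //.
    exact/measurable_EFinP/measurableT_comp.
  - move=> n x _; rewrite mule_ge0 //; first by rewrite lee_fin.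
    by rewrite EFinM nnfun_muleindic_ge0.
apply: eq_fsbigr => r rh; have r0 : (0 <= r)%R.
  by move: rh; rewrite inE => -[x _ <-]; exact: fun_ge0.
under eq_integral do rewrite EFinM.
rewrite ge0_integralZl//; last exact/measurable_EFinP.
rewrite integral_indic_mdensity//.
rewrite -ge0_integralZl//; last 2 first.
  - by apply: emeasurable_funM => //; exact/measurable_EFinP.
  - by move=> x _; rewrite mule_ge0 ?lee_fin.
by apply: eq_integral => x _; rewrite EFinM muleA [RHS]muleC.
Qed.

(** Linearity passes from indicators to simple functions; monotone convergence along
    [nnsfun_approx], applied on both sides, does the rest. *)
Lemma ge0_integral_mdensity (g : T -> \bar R) :
  measurable_fun setT g -> (forall x, 0 <= g x) ->
  \int[nu]_x g x = \int[mu]_x (g x * (f x)%:E).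
Proof.
move=> mg g0; pose g_ := nnsfun_approx measurableT mg.
transitivity (limn (fun n => \int[nu]_x (g_ n x)%:E)).
  rewrite -monotone_convergence//=.
  - by apply: eq_integral => x _; apply/esym/cvg_lim => //; exact: cvg_nnsfun_approx.
  - by move=> n; exact/measurable_EFinP.
  - by move=> n x _; rewrite lee_fin.
  - by move=> x _ a b ab; rewrite lee_fin//; exact/lefP/nd_nnsfun_approx.
rewrite (_ : \int[mu]_x _ = limn (fun n => \int[mu]_x ((g_ n x)%:E * (f x)%:E))).
  by congr (limn _); apply/funext => n; exact: integral_nnsfun_mdensity.
rewrite -monotone_convergence//=.
- apply: eq_integral => x _; apply/esym/cvg_lim => //.
  under eq_fun do rewrite muleC.
  rewrite muleC; apply: cvgeZl => //; exact: cvg_nnsfun_approx.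
- by move=> n; apply: emeasurable_funM => //; exact/measurable_EFinP.
- by move=> n x _; rewrite mule_ge0 ?lee_fin.
- move=> x _ a b ab; apply: lee_pmul; rewrite ?lee_fin//.
  exact/lefP/nd_nnsfun_approx.
Qed.

End mdensity.


(** * Product measures: change of density and moments of i.i.d. products *)

Section tuple_measure_integral.
Local Open Scope ereal_scope.
Context disp (T : measurableType disp) (R : realType).
Implicit Types (mu : {sigma_finite_measure set T -> \bar R}) (l g : T -> R).

Lemma ge0_integral_cons_measure mu n
    (nu : {sigma_finite_measure set (n.-tuple T) -> \bar R})
    (F : n.+1.-tuple T -> \bar R) :
  measurable_fun setT F -> (forall t, 0 <= F t) ->
  \int[cons_measure mu nu]_t F t =
  \int[mu]_x \int[nu]_t F (cons_pair (x, t)).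
Proof.
move=> mF F0; rewrite (ge0_integral_pushforward (@measurable_cons_pair _ T n))//.
rewrite preimage_setT fubini_tonelli1//; last by move=> z; exact: F0.
by apply: measurableT_comp => //; exact: measurable_cons_pair.
Qed.

Lemma measurable_prod_tnth l n : measurable_fun setT l ->
  measurable_fun setT (fun t : n.-tuple T => \prod_(i < n) l (tnth t i))%R.
Proof.
move=> ml; apply: measurable_prod => i _.
by apply: measurableT_comp => //; exact: measurable_tnth.
Qed.

Lemma prod_tnth_cons l n (z : T * n.-tuple T) :
  (\prod_(i < n.+1) l (tnth (cons_pair z) i) =
   l z.1 * \prod_(i < n) l (tnth z.2 i))%R.
Proof.
by rewrite big_ord_recl; congr (_ * _)%R; apply: eq_bigr => i _; rewrite tnthS.
Qed.

Lemma measurable_cons_pair2 n (x : T) :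
  measurable_fun setT (fun t : n.-tuple T => cons_pair (x, t)).
Proof.
exact: (measurableT_comp (@measurable_cons_pair _ T n) (pair1_measurable x)).
Qed.

(** By Tonelli the first coordinate splits off, so likelihoods multiply. The density [l] enters
    through an integral identity rather than through [mdensity], because the laws compared later are
    constructed independently of each other. *)
Lemma tuple_measure_change mu mu0 l :
  measurable_fun setT l -> (forall x, (0 <= l x)%R) ->
  (forall F : T -> \bar R, measurable_fun setT F -> (forall x, 0 <= F x) ->
    \int[mu]_x F x = \int[mu0]_x (F x * (l x)%:E)) ->
  forall n (F : n.-tuple T -> \bar R),
  measurable_fun setT F -> (forall t, 0 <= F t) ->
  \int[tuple_measure mu n]_t F t =
  \int[tuple_measure mu0 n]_t (F t * (\prod_(i < n) l (tnth t i))%:E).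
Proof.
move=> ml l0 mul; elim=> [|n IH] F mF F0.
  by apply: eq_integral => t _; rewrite big_ord0 mule1.
have p0 (t : n.-tuple T) : (0 <= \prod_(i < n) l (tnth t i))%R by apply: prodr_ge0.
have p1 (t : n.+1.-tuple T) : (0 <= \prod_(i < n.+1) l (tnth t i))%R by apply: prodr_ge0.
rewrite [LHS]ge0_integral_cons_measure// [RHS]ge0_integral_cons_measure; last 2 first.
- apply: emeasurable_funM => //; apply/measurable_EFinP.
  exact: measurable_prod_tnth.
- by move=> t; rewrite mule_ge0// lee_fin.
under eq_integral => x _.
  rewrite IH; last 2 first.
  - by apply: measurableT_comp => //; exact: measurable_cons_pair2.
  - by [].
  over.
have mFp : measurable_fun setT (fun z : T * n.-tuple T =>
    F (cons_pair z) * (\prod_(i < n) l (tnth z.2 i))%:E).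
  apply: emeasurable_funM.
    by apply: measurableT_comp => //; exact: measurable_cons_pair.
  apply/measurable_EFinP.
  apply: (@measurableT_comp _ _ _ _ _ _ (fun t : n.-tuple T => \prod_(i < n) l (tnth t i))%R _ snd).
exact: measurable_prod_tnth. exact: measurable_snd.
rewrite mul; last 2 first.
- apply: (measurable_fun_fubini_tonelli_F (m2 := tuple_measure mu0 n) _ mFp).
  by move=> z; rewrite mule_ge0// lee_fin.
- by move=> x; apply: integral_ge0 => t _; rewrite mule_ge0// lee_fin.
apply: eq_integral => x _; rewrite -ge0_integralZr//.
- by apply: eq_integral => t _; rewrite prod_tnth_cons/= EFinM -muleA [_ * (l x)%:E]muleC.
- exact: (measurableT_comp mFp (pair1_measurable x)).
- by move=> t _; rewrite mule_ge0// lee_fin.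
- by rewrite lee_fin.
Qed.

(** Independence: reduces the moments of the likelihood of a sample to those of one observation. *)
Lemma integral_tuple_measure_prod mu g (w : R) :
  measurable_fun setT g -> (forall x, (0 <= g x)%R) ->
  \int[mu]_x (g x)%:E = w%:E ->
  forall n, \int[tuple_measure mu n]_t (\prod_(i < n) g (tnth t i))%:E =
    (w ^+ n)%:E.
Proof.
move=> mg g0 gw; elim=> [|n IH].
  under eq_integral do rewrite big_ord0.
  by rewrite integral_dirac// diracT mul1e.
have p0 m (t : m.-tuple T) : (0 <= \prod_(i < m) g (tnth t i))%R by apply: prodr_ge0.
rewrite ge0_integral_cons_measure; last 2 first.
- by apply/measurable_EFinP; exact: measurable_prod_tnth.
- by move=> t; rewrite lee_fin.
transitivity (\int[mu]_x ((g x)%:E * (w ^+ n)%:E)).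
  apply: eq_integral => x _.
  transitivity (\int[tuple_measure mu n]_t
      ((g x)%:E * (\prod_(i < n) g (tnth t i))%:E)).
    by apply: eq_integral => t _; rewrite prod_tnth_cons EFinM.
  rewrite ge0_integralZl ?lee_fin ?IH//.
  - by apply/measurable_EFinP; exact: measurable_prod_tnth.
  - by move=> t _; rewrite lee_fin.
rewrite ge0_integralZr//.
- by rewrite gw exprS EFinM.
- exact/measurable_EFinP.
- by move=> x _; rewrite lee_fin.
- by rewrite lee_fin exprn_ge0// -lee_fin -gw integral_ge0// => x _; rewrite lee_fin.
Qed.

End tuple_measure_integral.


(* For a, b the likelihoods of two hypotheses relative to a reference and t a
   test, this bounds the sum of the two errors from below by moments of a and b
   alone, without a square root. It follows from
   min(a, b) * (1 - max(a, b) / 2)^2 >= 0. *)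
Lemma le_prod_mixture (R : realFieldType) (a b t : R) :
  0 <= a -> 0 <= b -> 0 <= t <= 1 ->
  a * b <= t * a + (1 - t) * b + 4^-1 * (a * b * a + a * b * b).
Proof.
move=> a0 b0 /andP[t0 t1].
wlog ab : a b t a0 b0 t0 t1 / a <= b.
  move=> H; have [|/ltW ba] := leP a b; first exact: H.
  have := H b a (1 - t) b0 a0; rewrite subr_ge0 lerBlDr lerDl => /(_ t1 t0 ba).
  lra.
have : a <= t * a + (1 - t) * b.
  have : 0 <= (1 - t) * (b - a) by apply: mulr_ge0; rewrite subr_ge0.
  lra.
have : 0 <= a * (1 - 2^-1 * b) ^+ 2 by rewrite mulr_ge0// sqr_ge0.
have : 0 <= a * b * a by rewrite !mulr_ge0.
lra.
Qed.

Lemma ge0_integralD_EFin d (T : measurableType d) (R : realType)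
    (mu : {measure set T -> \bar R}) (f g : T -> R) :
  measurable_fun setT f -> measurable_fun setT g ->
  (forall x, 0 <= f x) -> (forall x, 0 <= g x) ->
  (\int[mu]_x (f x + g x)%:E = \int[mu]_x (f x)%:E + \int[mu]_x (g x)%:E)%E.
Proof.
move=> mf mg f0 g0; under eq_integral do rewrite EFinD.
by rewrite ge0_integralD//; do ?[exact/measurable_EFinP|move=> x _; rewrite lee_fin].
Qed.

(** * Testing two hypotheses from n observations *)

Section two_point.
Local Open Scope ereal_scope.
Context disp (T : measurableType disp) (R : realType).
Implicit Types mu : {sigma_finite_measure set T -> \bar R}.

(** [le_prod_mixture] is integrated with a, b the likelihoods of the whole sample. The three moments
    that occur all equal w^n, which leaves the factor 1 - (1 + 1) / 4 = 1/2. *)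
Lemma two_point mu0 mu1 mu2 (l1 l2 : T -> R) (w : R) n (t : n.-tuple T -> R) :
  measurable_fun setT l1 -> (forall x, (0 <= l1 x)%R) ->
  measurable_fun setT l2 -> (forall x, (0 <= l2 x)%R) ->
  (forall F : T -> \bar R, measurable_fun setT F -> (forall x, 0 <= F x) ->
    \int[mu1]_x F x = \int[mu0]_x (F x * (l1 x)%:E)) ->
  (forall F : T -> \bar R, measurable_fun setT F -> (forall x, 0 <= F x) ->
    \int[mu2]_x F x = \int[mu0]_x (F x * (l2 x)%:E)) ->
  \int[mu0]_x (l1 x * l2 x)%:E = w%:E ->
  \int[mu0]_x (l1 x * l2 x * l1 x)%:E = w%:E ->
  \int[mu0]_x (l1 x * l2 x * l2 x)%:E = w%:E ->
  measurable_fun setT t -> (forall x, (0 <= t x <= 1)%R) ->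
  (2^-1 * w ^+ n)%:E <=
    \int[tuple_measure mu1 n]_x (t x)%:E +
    \int[tuple_measure mu2 n]_x (1 - t x)%:E.
Proof.
move=> ml1 l10 ml2 l20 mu1E mu2E w12 w121 w122 mt t01.
have t0 x : (0 <= t x)%R by case/andP: (t01 x).
have t1 x : (0 <= 1 - t x)%R by rewrite subr_ge0; case/andP: (t01 x).
have m1t : measurable_fun setT (fun x => 1 - t x)%R by exact: measurable_funB.
have ml12 : measurable_fun setT (fun x => l1 x * l2 x)%R by exact: measurable_funM.
have l120 x : (0 <= l1 x * l2 x)%R by rewrite mulr_ge0.
set a := fun x : n.-tuple T => (\prod_(i < n) l1 (tnth x i))%R.
set b := fun x : n.-tuple T => (\prod_(i < n) l2 (tnth x i))%R.
have a0 x : (0 <= a x)%R by apply: prodr_ge0.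
have b0 x : (0 <= b x)%R by apply: prodr_ge0.
have ma : measurable_fun setT a by exact: measurable_prod_tnth.
have mb : measurable_fun setT b by exact: measurable_prod_tnth.
have mta : measurable_fun setT (fun x => t x * a x)%R by exact: measurable_funM.
have mtb : measurable_fun setT (fun x => (1 - t x) * b x)%R by exact: measurable_funM.
have mab : measurable_fun setT (fun x => a x * b x)%R by exact: measurable_funM.
have maba : measurable_fun setT (fun x => a x * b x * a x)%R by exact: measurable_funM.
have mabb : measurable_fun setT (fun x => a x * b x * b x)%R by exact: measurable_funM.
have Iab : \int[tuple_measure mu0 n]_x (a x * b x)%:E = (w ^+ n)%:E.
  rewrite -(integral_tuple_measure_prod (mu := mu0) ml12 l120 w12).
  by apply: eq_integral => x _; rewrite -big_split.
have Iaba : \int[tuple_measure mu0 n]_x (a x * b x * a x)%:E = (w ^+ n)%:E.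
  rewrite -(integral_tuple_measure_prod (mu := mu0) (measurable_funM ml12 ml1) _ w121).
    by apply: eq_integral => x _; rewrite -!big_split.
  by move=> x /=; rewrite mulr_ge0.
have Iabb : \int[tuple_measure mu0 n]_x (a x * b x * b x)%:E = (w ^+ n)%:E.
  rewrite -(integral_tuple_measure_prod (mu := mu0) (measurable_funM ml12 ml2) _ w122).
    by apply: eq_integral => x _; rewrite -!big_split.
  by move=> x /=; rewrite mulr_ge0.
have -> : \int[tuple_measure mu1 n]_x (t x)%:E =
    \int[tuple_measure mu0 n]_x (t x * a x)%:E.
  rewrite (tuple_measure_change ml1 l10 mu1E)//; last exact/measurable_EFinP.
have -> : \int[tuple_measure mu2 n]_x (1 - t x)%:E =
    \int[tuple_measure mu0 n]_x ((1 - t x) * b x)%:E.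
  rewrite (tuple_measure_change ml2 l20 mu2E)//; last exact/measurable_EFinP.
have -> : (2^-1 * w ^+ n)%:E = (w ^+ n)%:E - (4^-1 * (w ^+ n + w ^+ n))%:E.
  by rewrite -EFinB; congr EFin; field.
rewrite leeBlDr// -[X in X <= _]Iab.
rewrite EFinM EFinD -[X in _ * (X + _)]Iaba -[X in _ * (_ + X)]Iabb.
rewrite -!ge0_integralD_EFin//; last 4 first.
- by move=> x; rewrite !mulr_ge0.
- by move=> x; rewrite !mulr_ge0.
- by move=> x; rewrite mulr_ge0.
- by move=> x; rewrite mulr_ge0.
rewrite -ge0_integralZl_EFin//; last 2 first.
- by move=> x _; rewrite lee_fin addr_ge0// !mulr_ge0.
- by apply/measurable_EFinP; exact: measurable_funD.
under [X in _ <= _ + X]eq_integral do rewrite -EFinM.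
rewrite -ge0_integralD_EFin//; last 4 first.
- exact: measurable_funD.
- by apply: measurable_funM => //; exact: measurable_funD.
- by move=> x; rewrite addr_ge0// mulr_ge0.
- by move=> x; rewrite mulr_ge0// addr_ge0// !mulr_ge0.
apply: ge0_le_integral => //.
- by move=> x _; rewrite lee_fin mulr_ge0.
- exact/measurable_EFinP.
- apply/measurable_EFinP; apply: measurable_funD; first exact: measurable_funD.
  by apply: measurable_funM => //; exact: measurable_funD.
- by move=> x _; rewrite lee_fin le_prod_mixture.
Qed.

End two_point.


(** * Classification risk and Assouad's lemma *)

Section joint_distribution.
Local Open Scope ereal_scope.
Context disp (T : measurableType disp) (R : realType) (mu : probability T R).
Variables (eta : T -> R).
Hypotheses (meta : measurable_fun setT eta) (eta01 : forall x, (0 <= eta x <= 1)%R).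

(** This is [mu] times the counting measure on labels, written as a sum of two images so that
    integrals split by label at once; the joint law has density [label_prob] with respect to it. *)
Definition labelled_measure : {measure set (T * bool) -> \bar R} :=
  measure_add
    (measure_function_pushforward__canonical__measure_function_Measure mu
      (pair2_measurable (T1 := T) true))
    (measure_function_pushforward__canonical__measure_function_Measure mu
      (pair2_measurable (T1 := T) false)).

Definition label_prob (f : T -> R) (z : T * bool) : R :=
  if z.2 then f z.1 else (1 - f z.1)%R.

Lemma measurable_label_prob : measurable_fun setT (label_prob eta).
Proof.
apply: (measurable_fun_if_pair (x := eta) (y := fun x => (1 - eta x)%R)) => //.
exact: measurable_funB.
Qed.

Lemma label_prob_ge0 z : (0 <= label_prob eta z)%R.
Proof.
by rewrite /label_prob; case: ifP => _; have /andP[? ?] := eta01 z.1; rewrite ?subr_ge0.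
Qed.

Definition joint_distribution : set (T * bool) -> \bar R :=
  mdensity labelled_measure measurable_label_prob label_prob_ge0.

HB.instance Definition _ := Measure.on joint_distribution.

Lemma ge0_integral_joint_distribution (F : T * bool -> \bar R) :
  measurable_fun setT F -> (forall z, 0 <= F z) ->
  \int[joint_distribution]_z F z =
  \int[mu]_x (F (x, true) * (eta x)%:E + F (x, false) * (1 - eta x)%:E).
Proof.
move=> mF F0.
have mp := measurable_label_prob.
have mFq : measurable_fun setT (fun z => F z * (label_prob eta z)%:E).
  by apply: emeasurable_funM => //; exact/measurable_EFinP.
have Fq0 z : 0 <= F z * (label_prob eta z)%:E.
  by rewrite mule_ge0// lee_fin label_prob_ge0.
rewrite [LHS]ge0_integral_mdensity// ge0_integral_measure_add//.
rewrite (ge0_integral_pushforward (pair2_measurable true))//.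
rewrite (ge0_integral_pushforward (pair2_measurable false))//.
rewrite !preimage_setT -ge0_integralD//.
- by move=> x _ /=; exact: Fq0.
- exact: (measurableT_comp mFq (pair2_measurable true)).
- by move=> x _ /=; exact: Fq0.
- exact: (measurableT_comp mFq (pair2_measurable false)).
Qed.

Lemma joint_distributionE A : measurable A ->
  joint_distribution A =
  \int[mu]_x ((\1_A (x, true) * eta x + \1_A (x, false) * (1 - eta x))%R)%:E.
Proof.
move=> mA; transitivity (\int[joint_distribution]_z (\1_A z)%:E).
  by rewrite integral_indic// setIT.
by rewrite ge0_integral_joint_distribution//; exact/measurable_EFinP.
Qed.

Lemma joint_distribution_setX A : measurable A ->
  joint_distribution (A `*` setT) = mu A.
Proof.
move=> mA; rewrite joint_distributionE; last exact: measurableX.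
rewrite -[A in RHS]setIT -integral_indic//; apply: eq_integral => x _; congr EFin.
rewrite !indicE !in_setX/= !in_setT !andbT; ring.
Qed.

Let joint_distribution_setT : joint_distribution setT = 1.
Proof. by rewrite -setXTT joint_distribution_setX// probability_setT. Qed.

HB.instance Definition _ :=
  Measure_isProbability.Build _ _ _ joint_distribution joint_distribution_setT.

Lemma joint_distribution_true A : measurable A ->
  joint_distribution (A `*` [set true]) = \int[mu]_(x in A) (eta x)%:E.
Proof.
move=> mA; rewrite joint_distributionE; last exact: measurableX.
rewrite [RHS]integral_mkcond; apply: eq_integral => x _.
rewrite patchE !indicE !in_setX/=.
rewrite (mem_set (_ : [set true] true))// (memNset (_ : ~ [set true] false))//.
by rewrite andbT andbF mul0r addr0; case: ifP => _; rewrite ?mul1r ?mul0r.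
Qed.

End joint_distribution.


(** * Averaging over sign vectors, and the excess risk on cells *)

Section flip.
Variable I : finType.
Implicit Types (k : I) (s : {ffun I -> bool}).

Definition flip k s : {ffun I -> bool} := [ffun j => (j == k) (+) s j].

Lemma flipK k : involutive (flip k).
Proof. by move=> s; apply/ffunP => j; rewrite !ffunE addbA addbb. Qed.

(** Averaging: [flip k] is an involution, so the sum of [G k] over all sign vectors is half the sum
    of the pairs bounded by hypothesis. The mean over [s] of the total is thus at least the claimed
    value, and some [s] reaches it. *)
Lemma exists_ge_sum_flip (R : realFieldType) (G : I -> {ffun I -> bool} -> R) (c : R) :
  (forall k s, c <= G k s + G k (flip k s)) ->
  exists s, #|I|%:R * c / 2 <= \sum_k G k s.
Proof.
move=> Gc; apply/not_existsP => Glt.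
have : \sum_(s : {ffun I -> bool}) \sum_k G k s <
       \sum_(s : {ffun I -> bool}) (#|I|%:R * c / 2).
  apply: ltr_sum => [|s _]; last by rewrite ltNge; apply/negP/Glt.
  by apply/hasP; exists [ffun=> true]; rewrite ?mem_index_enum.
apply/negP; rewrite -leNgt.
have -> : \sum_(s : {ffun I -> bool}) (#|I|%:R * c / 2) =
    2^-1 * \sum_(k : I) \sum_(s : {ffun I -> bool}) c.
  rewrite exchange_big big_distrr/=; apply: eq_bigr => s _.
  by rewrite sumr_const [LHS]mulrC mulr_natl.
rewrite [leRHS]exchange_big/= big_distrr/=; apply: ler_sum => k _.
rewrite ler_pdivrMl// [2 * _]mulr_natl mulr2n.
rewrite [X in _ <= _ + X](reindex_inj (can_inj (flipK k))) -big_split/=.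
exact: ler_sum.
Qed.

End flip.

Section classification_risk.
Local Open Scope ereal_scope.
Context disp (T : measurableType disp) (R : realType) (mu : probability T R).
Variables (eta : T -> R).
Hypotheses (meta : measurable_fun setT eta) (eta01 : forall x, (0 <= eta x <= 1)%R).

Lemma measurable_misclassified (f : T -> bool) : measurable_fun setT f ->
  measurable [set z : T * bool | f z.1 != z.2].
Proof.
move=> mf; rewrite (_ : [set _ | _] = (f @^-1` [set true] `*` [set false]) `|`
                                      (f @^-1` [set false] `*` [set true])).
  have mfb b : measurable (f @^-1` [set b]) by rewrite -[_ @^-1` _]setTI; exact: mf.
  by apply: measurableU; exact: measurableX.
apply/seteqP; split=> -[x b]/=; last by case=> -[-> ->].
by case: (f x); case: b => // _; [left|right].
Qed.

Lemma joint_distribution_misclassified (f : T -> bool) : measurable_fun setT f ->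
  joint_distribution mu meta eta01 [set z | f z.1 != z.2] =
  \int[mu]_x (if f x then 1 - eta x else eta x)%:E.
Proof.
move=> mf; rewrite joint_distributionE; last exact: measurable_misclassified.
apply: eq_integral => x _; congr EFin; rewrite !indicE.
by case: ifPn => fx; [rewrite memNset 1?mem_set|rewrite mem_set 1?memNset];
  rewrite /= ?fx ?(negbTE fx)// ?mul0r ?mul1r ?add0r ?addr0.
Qed.

(** The comparison is pointwise: the Bayes rule minimises the conditional error everywhere, and on a
    cell, where the regression function is at distance [h] from 1/2, the wrong label costs 2 h more.
    The additive form avoids subtracting extended reals. *)
Lemma misclassified_excess (I : finType) (C : I -> set T) (b : I -> bool) (h : R)
    (f : T -> bool) :
  measurable_fun setT f -> (forall k, measurable (C k)) -> trivIset setT C ->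
  (0 <= h)%R ->
  (forall k x, C k x -> eta x = (2^-1 + (if b k then h else - h))%R) ->
  joint_distribution mu meta eta01 [set z | (2^-1 <= eta z.1)%R != z.2] +
    \sum_k (2 * h)%:E * mu (C k `&` [set x | f x != b k]) <=
  joint_distribution mu meta eta01 [set z | f z.1 != z.2].
Proof.
move=> mf mC tC h0 etaC.
have mb : measurable_fun setT (fun x => 2^-1 <= eta x)%R.
  by apply: measurable_fun_ler.
have mfC k : measurable (C k `&` [set x | f x != b k]).
  apply: measurableI => //; rewrite (_ : [set _ | _] = f @^-1` [set ~~ b k]).
    by rewrite -[_ @^-1` _]setTI; exact: mf.
  by apply/seteqP; split=> x /=; case: (f x); case: (b k).
rewrite (joint_distribution_misclassified mf) (joint_distribution_misclassified mb).
under eq_bigr => k _.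
  rewrite -[X in mu X]setIT -integral_indic// -ge0_integralZl//; last 2 first.
  - exact/measurable_EFinP.
  - by rewrite lee_fin mulr_ge0.
  over.
rewrite -ge0_integral_sum//; last 2 first.
- by move=> k; apply: emeasurable_funM => //; exact/measurable_EFinP.
- by move=> k x _; rewrite mule_ge0// lee_fin// mulr_ge0.
have m1 : measurable_fun setT (fun x => (1 - eta x)%R) by exact: measurable_funB.
have e1 x : (0 <= 1 - eta x)%R by rewrite subr_ge0; case/andP: (eta01 x).
have e0 x : (0 <= eta x)%R by case/andP: (eta01 x).
rewrite -ge0_integralD//; last 4 first.
- by move=> x _; rewrite lee_fin; case: ifP.
- by apply/measurable_EFinP; exact: measurable_fun_ifT.
- by move=> x _; apply: sume_ge0 => k _; rewrite mule_ge0// lee_fin// mulr_ge0.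
- apply: emeasurable_sum => k _.
  by apply: emeasurable_funM => //; exact/measurable_EFinP.
apply: ge0_le_integral => //.
- move=> x _; rewrite adde_ge0//; first by rewrite lee_fin; case: ifP.
  by apply: sume_ge0 => k _; rewrite mule_ge0// lee_fin// mulr_ge0.
- apply: emeasurable_funD.
    by apply/measurable_EFinP; exact: measurable_fun_ifT.
  apply: emeasurable_sum => k _.
  by apply: emeasurable_funM => //; exact/measurable_EFinP.
- by apply/measurable_EFinP; exact: measurable_fun_ifT.
move=> x _; rewrite [X in _ + X](_ : _ =
    (\sum_k (2 * h) * \1_(C k `&` [set x | f x != b k]) x)%:E)%R; last first.
  by rewrite -sumEFin; apply: eq_bigr => k _; rewrite EFinM.
rewrite -EFinD lee_fin.
(* By disjointness at most one term of the sum is nonzero at [x]. *)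
have [[k Ck]|nC] := pselect (exists k, C k x); last first.
  rewrite big1 ?addr0; last first.
    move=> k _; rewrite indicE memNset ?mulr0//= => -[Ckx _].
    by apply: nC; exists k.
  case: ifPn; rewrite -?ltNge; case: ifP => _; lra.
rewrite (bigD1 k)//= big1 ?addr0; last first.
  move=> j jk; rewrite indicE memNset ?mulr0//= => -[Cjx _].
  by move/eqP: jk; apply; apply: tC => //; exists x.
rewrite (etaC _ _ Ck) indicE.
have [fb|fb] := eqVneq (f x) (b k).
  rewrite memNset/= ?mulr0 ?addr0; last by move=> -[_]; rewrite fb eqxx.
  rewrite fb; case: (b k); case: ifPn; rewrite -?ltNge; lra.
rewrite mem_set/=; last by split.
move: fb; case: (b k); case: (f x) => // _; case: ifPn; rewrite -?ltNge; lra.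
Qed.

End classification_risk.


Section assouad.
Local Open Scope ereal_scope.
Context disp (T : measurableType disp) (R : realType) (mu : probability T R).

Lemma integral_1B_indic (C : set T) (c m : R) : measurable C ->
  (0 <= c <= 1)%R -> mu C = m%:E ->
  \int[mu]_x (1 - c * \1_C x)%:E = (1 - c * m)%:E.
Proof.
move=> mC /andP[c0 c1] muC.
have mc : measurable_fun setT (fun x => c * \1_C x)%R by exact: measurable_funM.
have m1c : measurable_fun setT (fun x => 1 - c * \1_C x)%R by exact: measurable_funB.
have : \int[mu]_x (1 - c * \1_C x)%:E + \int[mu]_x (c * \1_C x)%:E = 1.
  rewrite -ge0_integralD_EFin//.
  - under eq_integral do rewrite subrK.
    rewrite [LHS](integral_cst mu measurableT 1%:E) mul1e; exact: probability_setT.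
  - move=> x; rewrite subr_ge0 indicE; case: (_ \in _) => /=; lra.
  - by move=> x; rewrite mulr_ge0.
under [X in _ + X]eq_integral do rewrite EFinM.
rewrite ge0_integralZl_EFin//; last exact/measurable_EFinP.
have -> : \int[mu]_x (\1_C x)%:E = m%:E by rewrite integral_indic// setIT; exact: muC.
rewrite -EFinM.
by move=> /(congr1 (fun x => x - (c * m)%:E)); rewrite addeK// -EFinB.
Qed.

(** Both laws have marginal [mu], so their likelihood ratio is that of the label given the point. *)
Lemma joint_distribution_change (eta0 eta1 : T -> R)
    (m0 : measurable_fun setT eta0) (m1 : measurable_fun setT eta1)
    (e0 : forall x, (0 <= eta0 x <= 1)%R) (e1 : forall x, (0 <= eta1 x <= 1)%R)
    (l : T * bool -> R) :
  measurable_fun setT l -> (forall z, (0 <= l z)%R) ->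
  (forall x, eta1 x = l (x, true) * eta0 x)%R ->
  (forall x, 1 - eta1 x = l (x, false) * (1 - eta0 x))%R ->
  forall F : T * bool -> \bar R, measurable_fun setT F -> (forall z, 0 <= F z) ->
  \int[joint_distribution mu m1 e1]_z F z =
  \int[joint_distribution mu m0 e0]_z (F z * (l z)%:E).
Proof.
move=> ml l0 lt lf F mF F0.
rewrite !ge0_integral_joint_distribution//.
- by apply: eq_integral => x _; rewrite lf lt !EFinM !muleA.
- by apply: emeasurable_funM => //; exact/measurable_EFinP.
- by move=> z; rewrite mule_ge0// lee_fin.
Qed.

Lemma integral_joint_EFin (eta : T -> R) (meta : measurable_fun setT eta)
    (e01 : forall x, (0 <= eta x <= 1)%R) (g : T * bool -> R) (g' : T -> R) :
  measurable_fun setT g -> (forall z, (0 <= g z)%R) ->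
  (forall x, g (x, true) * eta x + g (x, false) * (1 - eta x) = g' x)%R ->
  \int[joint_distribution mu meta e01]_z (g z)%:E = \int[mu]_x (g' x)%:E.
Proof.
move=> mg g0 gg'; rewrite ge0_integral_joint_distribution//.
- by apply: eq_integral => x _; rewrite -!EFinM -EFinD gg'.
- exact/measurable_EFinP.
Qed.

Lemma joint_two_point (eta1 eta2 : T -> R)
    (m1 : measurable_fun setT eta1) (m2 : measurable_fun setT eta2)
    (e1 : forall x, (0 <= eta1 x <= 1)%R) (e2 : forall x, (0 <= eta2 x <= 1)%R)
    (C : set T) (h m : R) n (t : n.-tuple (T * bool) -> R) :
  measurable C -> (0 <= h <= 2^-1)%R -> mu C = m%:E ->
  (forall x, C x -> eta1 x = 2^-1 + h /\ eta2 x = 2^-1 - h)%R ->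
  (forall x, ~ C x -> eta1 x = eta2 x) ->
  measurable_fun setT t -> (forall x, (0 <= t x <= 1)%R) ->
  (2^-1 * (1 - 4 * h ^+ 2 * m) ^+ n)%:E <=
    \int[tuple_measure (joint_distribution mu m1 e1) n]_s (t s)%:E +
    \int[tuple_measure (joint_distribution mu m2 e2) n]_s (1 - t s)%:E.
Proof.
move=> mC /andP[h0 h2] muC etaC etaNC mt t01.
(* The reference is the midpoint, relative to which the two likelihoods are
   1 + z and 1 - z; their product and the two cubic moments integrate alike. *)
pose eta0 x : R := (2^-1 * (eta1 x + eta2 x))%R.
have m0 : measurable_fun setT eta0 by apply: measurable_funM => //; exact: measurable_funD.
have e0 x : (0 <= eta0 x <= 1)%R.
  by rewrite /eta0; have /andP[? ?] := e1 x; have /andP[? ?] := e2 x; apply/andP; split; lra.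
pose z (y : T * bool) : R := (\1_C y.1 * (if y.2 then 2 * h else - (2 * h)))%R.
have mz : measurable_fun setT z.
  apply: measurable_funM; first exact: (measurableT_comp (measurable_indic mC)).
  by apply: measurable_fun_ifT.
pose l1 y : R := (1 + z y)%R; pose l2 y : R := (1 - z y)%R.
have ml1 : measurable_fun setT l1 by exact: measurable_funD.
have ml2 : measurable_fun setT l2 by exact: measurable_funB.
have l10 y : (0 <= l1 y)%R.
  by rewrite /l1 /z indicE; case: (_ \in _); case: ifP => _ /=; lra.
have l20 y : (0 <= l2 y)%R.
  by rewrite /l2 /z indicE; case: (_ \in _); case: ifP => _ /=; lra.
have cases x : ((\1_C x : R) = 1 /\ eta1 x = 2^-1 + h /\ eta2 x = 2^-1 - h \/
                (\1_C x : R) = 0 /\ eta1 x = eta2 x)%R.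
  have [Cx|nCx] := pselect (C x); [left|right]; rewrite indicE.
    by rewrite mem_set//; split=> //; exact: etaC.
  by rewrite memNset//; split=> //; exact: etaNC.
pose c : R := (4 * h ^+ 2)%R.
have c01 : (0 <= c <= 1)%R.
  by rewrite /c; apply/andP; split; nra.
have Iw : \int[mu]_x (1 - c * \1_C x)%:E = (1 - c * m)%:E by exact: integral_1B_indic.
apply: (two_point (mu0 := joint_distribution mu m0 e0) ml1 l10 ml2 l20) => //.
- apply: joint_distribution_change => // x; rewrite /l1 /z /eta0 /=.
  + by case: (cases x) => [[-> [-> ->]]|[-> ->]]; field.
  + by case: (cases x) => [[-> [-> ->]]|[-> ->]]; field.
- apply: joint_distribution_change => // x; rewrite /l2 /z /eta0 /=.
  + by case: (cases x) => [[-> [-> ->]]|[-> ->]]; field.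
  + by case: (cases x) => [[-> [-> ->]]|[-> ->]]; field.
(* On [C] the midpoint is 1/2 and z = 2 h or - 2 h with equal weights, hence z has mean 0 given the
   point. So l1 l2 = 1 - z^2, l1 l2 l1 and l1 l2 l2 all have conditional mean 1 - 4 h^2 on [C], and
   1 off [C]. *)
- rewrite -Iw; apply: integral_joint_EFin => [|y|x]; first exact: measurable_funM.
    by rewrite mulr_ge0.
  by rewrite /l1 /l2 /z /eta0 /c/=; case: (cases x) => [[-> [-> ->]]|[-> ->]]; field.
- rewrite -Iw; apply: integral_joint_EFin => [|y|x].
  + by apply: measurable_funM => //; exact: measurable_funM.
  + by rewrite !mulr_ge0.
  + by rewrite /l1 /l2 /z /eta0 /c/=; case: (cases x) => [[-> [-> ->]]|[-> ->]]; field.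
- rewrite -Iw; apply: integral_joint_EFin => [|y|x].
  + by apply: measurable_funM => //; exact: measurable_funM.
  + by rewrite !mulr_ge0.
  + by rewrite /l1 /l2 /z /eta0 /c/=; case: (cases x) => [[-> [-> ->]]|[-> ->]]; field.
Qed.

End assouad.


Lemma bernoulli_ineq (R : realDomainType) (c : R) n :
  0 <= c <= 1 -> 1 - n%:R * c <= (1 - c) ^+ n.
Proof.
move=> /andP[c0 c1]; elim: n => [|n IH]; first by rewrite mul0r subr0 expr0.
have : (1 - c) * (1 - n%:R * c) <= (1 - c) ^+ n.+1.
  by rewrite exprS ler_wpM2l// subr_ge0.
apply: le_trans; rewrite -natr1.
have : 0 <= n%:R * c * c by rewrite !mulr_ge0.
by nra.
Qed.

(** * Assouad's lemma for a family of regression functions indexed by signs *)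

Section assouad_main.
Local Open Scope ereal_scope.
Context disp (T : measurableType disp) (R : realType) (mu : probability T R).
Context (I : finType) (C : I -> set T) (m hP hQ : R).
Hypotheses (mC : forall k, measurable (C k)) (tC : trivIset setT C)
  (m0 : (0 < m)%R) (muC : forall k, mu (C k) = m%:E)
  (hP01 : (0 <= hP <= 2^-1)%R) (hQ0 : (0 <= hQ)%R).
Variables (etaP etaQ : {ffun I -> bool} -> T -> R).
Hypotheses (mP : forall s, measurable_fun setT (etaP s))
  (mQ : forall s, measurable_fun setT (etaQ s))
  (eP : forall s x, (0 <= etaP s x <= 1)%R)
  (eQ : forall s x, (0 <= etaQ s x <= 1)%R).
Hypotheses
  (etaPC : forall (s : {ffun I -> bool}) k x, C k x ->
     etaP s x = (2^-1 + (if s k then hP else - hP))%R)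
  (etaQC : forall (s : {ffun I -> bool}) k x, C k x ->
     etaQ s x = (2^-1 + (if s k then hQ else - hQ))%R)
  (etaPflip : forall s k x, ~ C k x -> etaP (flip k s) x = etaP s x).
Variables (n : nat) (fhat : n.-tuple (T * bool) -> T -> bool).
Hypothesis mf : measurable_fun setT (fun z : n.-tuple (T * bool) * T => fhat z.1 z.2).
Hypothesis small : (n%:R * (4 * hP ^+ 2 * m) <= 2^-1)%R.

Let Jn s := tuple_measure (joint_distribution mu (mP s) (eP s)) n.

Let err k b u : set T := C k `&` [set x | fhat u x != b].

Let mfhat u : measurable_fun setT (fhat u).
Proof. exact: (measurableT_comp mf (pair1_measurable u)). Qed.

Let merr k b u : measurable (err k b u).
Proof.
apply: measurableI => //; rewrite (_ : [set _ | _] = fhat u @^-1` [set ~~ b]).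
  by rewrite -[_ @^-1` _]setTI; exact: mfhat.
by apply/seteqP; split=> x /=; case: (fhat u x); case: b.
Qed.

(** The fraction of a cell on which the trained classifier differs from [b] serves as a randomised
    test of the sign of that cell; [t_compl] says that testing for the other sign is the
    complementary test. *)
Let t k b u : R := (fine (mu (err k b u)) / m)%R.

Let errE k b u : mu (err k b u) = (m * t k b u)%:E.
Proof.
rewrite /t mulrC divfK ?gt_eqF// fineK//.
exact: fin_num_measure.
Qed.

Let t_ge0 k b u : (0 <= t k b u)%R.
Proof. by rewrite divr_ge0 ?(ltW m0)// fine_ge0. Qed.

Let t_compl k b u : t k (~~ b) u = (1 - t k b u)%R.
Proof.
have : mu (C k) = mu (err k b u) + mu (err k (~~ b) u).
  rewrite -measureU//.
    congr (mu _); apply/seteqP; split=> x; last by case=> -[].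
    by move=> Cx; case: (eqVneq (fhat u x) b) => fb; [right|left]; split=> //=;
      rewrite fb; case: (b).
  apply/seteqP; split=> x // -[[_ /= +] [_ /=]].
  by case: (fhat u x); case: (b).
rewrite muC !errE -EFinD => -[] /(congr1 (fun x => x / m)%R).
rewrite divff ?gt_eqF// => mm.
apply: (mulfI (x := m)); rewrite ?gt_eqF//.
by move: mm; rewrite -mulrDr mulrC mulKf ?gt_eqF// => ->; rewrite addrAC subrr add0r.
Qed.

Let t01 k b u : (0 <= t k b u <= 1)%R.
Proof. by rewrite t_ge0/= -subr_ge0 -t_compl. Qed.

Let mt k b : measurable_fun setT (t k b).
Proof.
apply: measurable_funM => //.
(* The masses are those of the sections of [A], which is measurable because [fhat] is so jointly in
   the sample and the point. *)
pose A := [set z : n.-tuple (T * bool) * T | C k z.2 /\ fhat z.1 z.2 != b].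
have mA : measurable A.
  rewrite (_ : A = snd @^-1` (C k) `&` (fun z => fhat z.1 z.2) @^-1` [set ~~ b]).
    apply: measurableI.
      by rewrite -[_ @^-1` _]setTI; exact: measurable_snd.
    by rewrite -[_ @^-1` _]setTI; exact: mf.
  by apply/seteqP; split=> -[x y]; rewrite /A/= => -[Cy fb]; split=> //;
    move: fb; case: (fhat x y); case: (b).
have -> : (fun u => fine (mu (err k b u))) = fine \o (mu \o xsection A).
  apply/funext => u /=; congr (fine (mu _)); apply/seteqP; split=> x.
    by move=> [? ?]; rewrite /xsection/= inE.
  by rewrite /xsection/= inE.
apply: measurableT_comp; first exact: fine_measurable.
exact: measurable_fun_xsection.
Qed.

Let G k (s : {ffun I -> bool}) := fine (\int[Jn s]_u (t k (s k) u)%:E).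

Let int1 s : \int[Jn s]_u 1%:E = 1.
Proof.
have J1 : \int[joint_distribution mu (mP s) (eP s)]_u 1%:E = 1%:E.
  rewrite [LHS](integral_cst _ measurableT 1%:E) mul1e; exact: probability_setT.
have := integral_tuple_measure_prod (mu := joint_distribution mu (mP s) (eP s))
  (measurable_cst (1 : R)%R) (fun _ => ler01) J1 n.
rewrite expr1n; apply: etrans.
by apply: eq_integral => u _; rewrite big1.
Qed.

Let int_fin s k b : \int[Jn s]_u (t k b u)%:E \is a fin_num.
Proof.
rewrite ge0_fin_numE; last by apply: integral_ge0 => u _; rewrite lee_fin.
apply: (@le_lt_trans _ _ 1); last exact: ltry.
rewrite -(int1 s); apply: ge0_le_integral => //.
- by move=> u _; rewrite lee_fin.
- exact/measurable_EFinP.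
- by move=> u _; rewrite lee_fin; case/andP: (t01 k b u).
Qed.

Let GE k s : (G k s)%:E = \int[Jn s]_u (t k (s k) u)%:E.
Proof. by rewrite /G fineK. Qed.

Let hPm_ge0 : (0 <= 4 * hP ^+ 2 * m)%R.
Proof. by rewrite mulr_ge0 ?(ltW m0)// mulr_ge0// sqr_ge0. Qed.

Let m_le1 : n != 0%N -> (4 * hP ^+ 2 * m <= 1)%R.
Proof.
move=> n0; have : (1 * (4 * hP ^+ 2 * m) <= n%:R * (4 * hP ^+ 2 * m))%R.
  by rewrite ler_wpM2r ?ler1n ?lt0n.
rewrite mul1r => /le_trans /(_ small) /le_trans; apply.
by rewrite invf_le1 ?ler1n.
Qed.

(** The two sign vectors differ on cell [k] only, so [joint_two_point] applies. With c = 4 hP^2 m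
    and n c <= 1/2, Bernoulli's inequality gives 1/2 (1 - c)^n >= 1/2 (1 - n c) >= 1/4. *)
Let G_flip k s : (4^-1 <= G k s + G k (flip k s))%R.
Proof.
wlog sk : s / s k.
  move=> H; case: (boolP (s k)) => sk; first exact: H.
  rewrite addrC -[in X in (_ + X)%R](flipK k s); apply: H.
  by rewrite ffunE eqxx (negbTE sk).
have sk' : flip k s k = false by rewrite ffunE eqxx sk.
rewrite -lee_fin EFinD !GE sk sk'.
under [X in _ <= _ + X]eq_integral do rewrite (t_compl k true).
apply: le_trans (joint_two_point (mP s) (mP (flip k s)) (eP s) (eP (flip k s))
  (mC k) hP01 (muC k) _ _ (mt k true) (t01 k true)).
(* For n = 0 the hypothesis [small] does not bound 4 hP^2 m, but the power is 1. *)
- rewrite lee_fin; have [->|n0] := eqVneq n 0%N; first by rewrite expr0; lra.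
  have := @bernoulli_ineq R (4 * hP ^+ 2 * m) n.
  rewrite hPm_ge0 m_le1// => /(_ isT).
  by move: small; lra.
- by move=> x Ckx; rewrite !(etaPC _ Ckx) sk sk'.
- by move=> x nCk; rewrite etaPflip.
Qed.

(** Given the sample, the excess risk is at least the sum over cells of 2 hQ m times the test error.
    [G_flip] and averaging produce one sign vector whose expected errors sum to at least #|I| / 8,
    hence the factor 1/4. The risk of the Bayes rule stays on the left to avoid a subtraction. *)
Lemma assouad : exists s,
  joint_distribution mu (mQ s) (eQ s) [set z | (2^-1 <= etaQ s z.1)%R != z.2] +
    (hQ * m * #|I|%:R / 4)%:E <=
  \int[Jn s]_u joint_distribution mu (mQ s) (eQ s) [set z | fhat u z.1 != z.2].
Proof.
have [s sG] := exists_ge_sum_flip G_flip; exists s.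
set B := joint_distribution _ _ _ _.
have B0 : 0 <= B by exact: measure_ge0.
have c0 : (0 <= 2 * hQ * m)%R by rewrite mulr_ge0 ?(ltW m0)// mulr_ge0.
pose b u := B + \sum_k (2 * hQ * m)%:E * (t k (s k) u)%:E.
have mterm k : measurable_fun setT (fun u => (2 * hQ * m)%:E * (t k (s k) u)%:E).
  by apply: emeasurable_funM => //; exact/measurable_EFinP.
have term0 k u : 0 <= (2 * hQ * m)%:E * (t k (s k) u)%:E.
  by rewrite mule_ge0// lee_fin.
apply: (@le_trans _ _ (\int[Jn s]_u b u)).
  rewrite /b ge0_integralD//; last 2 first.
  - by move=> u _; apply: sume_ge0.
  - exact: emeasurable_sum.
  have -> : \int[Jn s]_u B = B.
    rewrite [LHS](_ : _ = \int[Jn s]_u (B * 1%:E)).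
      by rewrite ge0_integralZl// ?int1 ?mule1.
    by apply: eq_integral => u _; rewrite mule1.
  apply: leeD => //; rewrite ge0_integral_sum//.
  under eq_bigr => k _.
    rewrite ge0_integralZl_EFin//; last 2 first.
    - by move=> u _; rewrite lee_fin.
    - exact/measurable_EFinP.
    rewrite -GE -EFinM; over.
  rewrite sumEFin lee_fin -big_distrr/=.
  apply: le_trans (ler_wpM2l c0 sG).
  by rewrite le_eqVlt; apply/orP; left; apply/eqP; field.
apply: ge0_le_integral => //.
- by move=> u _; rewrite /b adde_ge0// sume_ge0.
- by apply: emeasurable_funD => //; exact: emeasurable_sum.
- pose A := [set z : n.-tuple (T * bool) * (T * bool) | fhat z.1 z.2.1 != z.2.2].
  have -> : (fun u => joint_distribution mu (mQ s) (eQ s) [set z | fhat u z.1 != z.2])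
      = (joint_distribution mu (mQ s) (eQ s) \o xsection A).
    apply/funext => u /=; congr (joint_distribution _ _ _ _).
    by apply/seteqP; split=> z; rewrite /xsection/= inE.
  apply: measurable_fun_xsection.
  have mg : measurable_fun setT
      (fun z : n.-tuple (T * bool) * (T * bool) => fhat z.1 z.2.1).
    apply: (measurableT_comp mf (f := fun z => fhat z.1 z.2)
      (g := fun z : n.-tuple (T * bool) * (T * bool) => (z.1, z.2.1))).
    apply: measurable_fun_pair => //.
    exact: measurableT_comp.
  rewrite (_ : A = ((fun z => fhat z.1 z.2.1) @^-1` [set true] `&` (fun z => z.2.2) @^-1` [set false])
    `|` ((fun z => fhat z.1 z.2.1) @^-1` [set false] `&` (fun z => z.2.2) @^-1` [set true])).
    have mgb c : measurable ((fun z : n.-tuple (T * bool) * (T * bool) => fhat z.1 z.2.1) @^-1` [set c]).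
      by rewrite -[_ @^-1` _]setTI; exact: mg.
    have mlb c : measurable ((fun z : n.-tuple (T * bool) * (T * bool) => z.2.2) @^-1` [set c]).
      rewrite -[_ @^-1` _]setTI.
      exact: (measurableT_comp measurable_snd measurable_snd).
    by apply: measurableU; exact: measurableI.
  apply/seteqP; split=> -[u [x c]] /=; rewrite /A/=.
    by case: (fhat u x); case: c => // _; [left|right].
  by case=> -[-> ->].
- move=> u _; rewrite /b.
  rewrite (eq_bigr (fun k => (2 * hQ)%:E * mu (err k (s k) u))); last first.
    by move=> k _; rewrite errE; congr EFin; exact/esym/mulrA.
  apply: (misclassified_excess (b := s) mu (mQ s) (eQ s) (mfhat u) mC tC hQ0).
  exact: etaQC.
Qed.

End assouad_main.


(** * The domain *)

Lemma prode_const (R : realType) (l : R) n : (\prod_(i < n) l%:E = (l ^+ n)%:E)%E.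
Proof.
elim: n => [|n IH]; first by rewrite big_ord0.
by rewrite big_ord_recl IH exprS EFinM.
Qed.

Lemma le_prode_const (R : realType) (l : R) n (f : 'I_n -> \bar R) :
  0 <= l -> (forall i, l%:E <= f i)%E -> ((l ^+ n)%:E <= \prod_(i < n) f i)%E.
Proof.
move=> l0; elim: n f => [|n IH] f lf; first by rewrite big_ord0.
rewrite big_ord_recl exprS EFinM lee_pmul ?lee_fin ?exprn_ge0//.
by apply: IH => i; exact: lf.
Qed.

Section lebesgue_product.
Context (R : realType).
Local Notation lambda := (@lebesgue_measure R).

Lemma lebesgue_measure_cc (a b : R) : a <= b ->
  lambda [set y : measurableTypeR R | a <= (y : R) <= b] = (b - a)%:E.
Proof.
move=> ab; rewrite (_ : [set _ | _] = [set` `[a, b]]); last first.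
  by apply/seteqP; split=> y /=; rewrite in_itv.
rewrite lebesgue_measure_itv/= lte_fin; case: ltP => // ba.
by rewrite (@le_anti _ _ a b) ?ab// subrr.
Qed.

Lemma measurable_cc (a b : R) :
  measurable [set y : measurableTypeR R | a <= (y : R) <= b].
Proof.
rewrite (_ : [set _ | _] = [set` `[a, b]]); first exact: measurable_itv.
by apply/seteqP; split=> y /=; rewrite in_itv.
Qed.

Lemma measurable_co (a b : R) :
  measurable [set y : measurableTypeR R | a <= (y : R) < b].
Proof.
rewrite (_ : [set _ | _] = [set` `[a, b[]); first exact: measurable_itv.
by apply/seteqP; split=> y /=; rewrite in_itv.
Qed.

Variable d : nat.
Implicit Types (x y : euclidean R d) (A : 'I_d -> set (measurableTypeR R)).

Definition box A : set (euclidean R d) := [set x | forall i, A i (tnth x i)].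

Lemma measurable_box A : (forall i, measurable (A i)) -> measurable (box A).
Proof.
move=> mA; rewrite (_ : box A = \bigcap_(i in [set: 'I_d]) ((@tnth d _ ^~ i) @^-1` A i)).
  apply: fin_bigcap_measurable; first exact: finite_finset.
  by move=> i _; rewrite -[X in measurable X]setTI; exact: measurable_tnth.
by apply/seteqP; split=> t /= h i; [move=> _|]; exact: h.
Qed.

Lemma lebesgue_box A : (forall i, measurable (A i)) ->
  lebesgue (box A) = (\prod_(i < d) lambda (A i))%E.
Proof. exact: tuple_measureE. Qed.

Lemma lebesgue_cube (a : 'I_d -> R) (l : R) : 0 <= l ->
  lebesgue (box (fun i => [set y | a i <= (y : R) <= a i + l])) = (l ^+ d)%:E.
Proof.
move=> l0; rewrite lebesgue_box; last by move=> i; exact: measurable_cc.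
rewrite (eq_bigr (fun=> l%:E)); last first.
  by move=> i _; rewrite lebesgue_measure_cc ?lerDl// addrAC subrr add0r.
exact: prode_const.
Qed.

Lemma dist_tnth x y i : `|(tnth x i : R) - tnth y i| <= edist x y.
Proof.
rewrite /edist -sqrtr_sqr ler_wsqrtr// (bigD1 i)//= lerDl sumr_ge0// => j _.
exact: sqr_ge0.
Qed.

Lemma edist_ge0 x y : 0 <= edist x y.
Proof. exact: sqrtr_ge0. Qed.

(** The factor [d], cruder than its square root, is enough and keeps the constants free of roots. *)
Lemma edist_lt x y (l r : R) : (0 < d)%N -> 0 < l -> d%:R * l < r ->
  (forall i, `|(tnth x i : R) - tnth y i| <= l) -> edist x y < r.
Proof.
move=> d0 l0 lr xyl; apply: le_lt_trans lr.
have dl0 : 0 <= d%:R * l by rewrite mulr_ge0// ltW.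
rewrite -[leRHS](ger0_norm dl0).
rewrite -sqrtr_sqr ler_wsqrtr//.
apply: (@le_trans _ _ (\sum_(i < d) l ^+ 2)).
  apply: ler_sum => i _; rewrite -real_normK ?num_real//.
  by rewrite lerXn2r// nnegrE ?ltW.
have -> : \sum_(i < d) l ^+ 2 = d%:R * l ^+ 2.
  by rewrite sumr_const card_ord mulr_natl.
rewrite exprMn; apply: ler_wpM2r; first exact: sqr_ge0.
by rewrite expr2 ler_peMl// ler1n.
Qed.

Lemma measurable_eball x (r : R) : 0 < r -> measurable (eball x r).
Proof.
move=> r0; pose f y : R := \sum_(i < d) ((tnth x i : R) - tnth y i) ^+ 2.
have f0 y : 0 <= f y by apply: sumr_ge0 => i _; exact: sqr_ge0.
have mf : measurable_fun setT f.
  apply: measurable_sum => i.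
  apply: measurable_funX; apply: measurable_funB => //.
  exact: measurable_tnth.
rewrite (_ : eball x r = f @^-1` [set` `]-oo, r ^+ 2[]).
  by rewrite -[X in measurable X]setTI; apply: mf => //; exact: measurable_itv.
apply/seteqP; split=> y; rewrite /eball/edist/= in_itv/= -/(f y).
  by rewrite -[in X in X -> _](ger0_norm (ltW r0)) -sqrtr_sqr ltr_sqrt// exprn_gt0.
by rewrite -[in X in _ -> X](ger0_norm (ltW r0)) -sqrtr_sqr ltr_sqrt// exprn_gt0.
Qed.

Lemma lebesgue_eball_le x (r : R) : 0 < r ->
  (lebesgue (eball x r) <= ((2 * r) ^+ d)%:E)%E.
Proof.
move=> r0; rewrite -(lebesgue_cube (fun i => (tnth x i : R) - r)); last first.
  by rewrite mulr_ge0// ltW.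
apply: le_measure; rewrite ?inE.
- exact: measurable_eball.
- by apply: measurable_box => i; exact: measurable_cc.
move=> y /= xy i; have := le_lt_trans (dist_tnth x y i) xy.
by rewrite ltr_norml => /andP[? ?]; apply/andP; split; lra.
Qed.

End lebesgue_product.


(** * The one-dimensional comb *)

Section comb.
Context (R : realType) (s : R).
Hypothesis s0 : 0 < s.
Local Notation lambda := (@lebesgue_measure R).
Implicit Types (k M i j : nat) (y z : R).

(** Period 2 s and length s leave gaps of length s, which allow a jump of order s^e between
    neighbours. The intervals are closed because the domain has to be a support. *)
Definition tooth k : set (measurableTypeR R) :=
  [set y | k%:R * (2 * s) <= (y : R) <= k%:R * (2 * s) + s].

Definition comb M : set (measurableTypeR R) := \bigcup_(k in `I_M) tooth k.

Lemma measurable_tooth k : measurable (tooth k).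
Proof. exact: measurable_cc. Qed.

Lemma lebesgue_tooth k : lambda (tooth k) = s%:E.
Proof. by rewrite lebesgue_measure_cc ?lerDl ?(ltW s0)// addrAC subrr add0r. Qed.

Lemma measurable_comb M : measurable (comb M).
Proof.
apply: fin_bigcup_measurable; first exact: finite_II.
by move=> k _; exact: measurable_tooth.
Qed.

Lemma tooth_far j k y z : j != k -> tooth j y -> tooth k z -> s <= `|y - z|.
Proof.
wlog jk : j k y z / (j < k)%N.
  move=> H jk tj tk; case: (ltngtP j k) => jk'; first exact: (H j k).
    by rewrite distrC; apply: (H k j) => //; rewrite eq_sym.
  by rewrite jk' eqxx in jk.
move=> _ /andP[_ yj] /andP[kz _].
have : (j%:R + 1) * (2 * s) <= k%:R * (2 * s).
  by rewrite ler_wpM2r ?natr1 ?ler_nat// mulr_ge0// ltW.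
move=> jk2; rewrite distrC; apply: le_trans (ler_norm _).
move: jk2; rewrite mulrDl; lra.
Qed.

Lemma comb_bound M y : comb M y -> 0 <= y <= M%:R * (2 * s).
Proof.
move=> [k /= kM /andP[ky yk]]; apply/andP; split.
  by apply: le_trans ky; rewrite mulr_ge0// mulr_ge0// ltW.
have : (k%:R + 1) * (2 * s) <= M%:R * (2 * s).
  by rewrite ler_wpM2r ?natr1 ?ler_nat// mulr_ge0// ltW.
move: s0; rewrite mulrDl; lra.
Qed.

Lemma comb_closed M y : ~ comb M y ->
  exists2 r, 0 < r & forall z, `|y - z| < r -> ~ comb M z.
Proof.
elim: M => [_|M IH nc].
  by exists 1 => // z _ [k].
have [|r r0 ry] := IH.
  by move=> [k kM ky]; apply: nc; exists k => //=; exact: ltnW.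
have nt : ~ tooth M y by move=> t; apply: nc; exists M => //=.
have [r' r'0 r'y] : exists2 r, 0 < r & forall z, `|y - z| < r -> ~ tooth M z.
  have [yM|My] := ltP y (M%:R * (2 * s)).
    exists (M%:R * (2 * s) - y); rewrite ?subr_gt0// => z.
    rewrite ltr_norml => /andP[? ?] /andP[? ?]; lra.
  have [yM|My'] := ltP (M%:R * (2 * s) + s) y.
    exists (y - (M%:R * (2 * s) + s)); rewrite ?subr_gt0// => z.
    rewrite ltr_norml => /andP[? ?] /andP[? ?]; lra.
  by exfalso; apply: nt; rewrite /tooth/= My My'.
exists (Num.min r r'); first by rewrite lt_min r0.
move=> z; rewrite lt_min => /andP[zr zr'] [k /= kM tkz].
move: kM; rewrite ltnS leq_eqVlt => /orP[/eqP kM|kM].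
  by apply: (r'y z zr'); rewrite -kM.
by apply: (ry z zr); exists k.
Qed.

(** Each period contains one tooth, so a run of whole periods is half filled. The half-open window
    makes the next tooth disjoint from what has been counted. *)
Lemma lebesgue_comb_blocks M i j : (i + j <= M)%N ->
  ((j%:R * s)%:E <=
   lambda (comb M `&` [set y : measurableTypeR R |
     (i%:R * (2 * s) <= (y : R) < (i + j)%:R * (2 * s))%R]))%E.
Proof.
elim: j => [|j IH] ijM; first by rewrite mul0r measure_ge0.
set A := comb M `&` _.
pose B := comb M `&` [set y : measurableTypeR R |
     i%:R * (2 * s) <= (y : R) < (i + j)%:R * (2 * s)].
have iij : i%:R * (2 * s) <= (i + j)%:R * (2 * s).
  by rewrite ler_wpM2r ?ler_nat ?leq_addr// mulr_ge0// ltW.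
have ij1 : (i + j.+1)%:R * (2 * s) = (i + j)%:R * (2 * s) + 2 * s.
  by rewrite addnS -natr1 mulrDl mul1r.
have mB : measurable B by apply: measurableI; [exact: measurable_comb|exact: measurable_co].
have mA : measurable A by apply: measurableI; [exact: measurable_comb|exact: measurable_co].
apply: (@le_trans _ _ (lambda (B `|` tooth (i + j)))); last first.
  apply: le_measure; rewrite ?inE//; first by apply: measurableU => //; exact: measurable_tooth.
  move=> y [[cy /andP[iy yij]]|ty].
    by split=> //=; rewrite iy/= ij1; move: s0; lra.
  split; first by exists (i + j)%N => //=; rewrite -addnS.
  by move: ty => /andP[? ?] /=; rewrite ij1; apply/andP; split; move: s0; lra.
rewrite measureU//; last 2 first.
- exact: measurable_tooth.
- apply/seteqP; split=> y // -[[_ /andP[_ yij]] /andP[ijy _]].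
  by move: yij ijy => /=; lra.
rewrite -natr1 mulrDl mul1r EFinD leeD//.
  by apply: IH; apply: leq_trans ijM; rewrite leq_add2l.
by rewrite [leRHS](lebesgue_tooth _).
Qed.

(** The comb fills a fixed proportion of every window centred in it, whether the window is shorter
    than a period (one tooth suffices) or longer (whole periods are counted). Both regimes give at
    least l / 16. The range of [l] goes up to four times the extent of the comb because [domain_box]
    turns to [outer] only beyond that. *)
Lemma lebesgue_comb_near M (y l : R) : comb M y -> 0 < l <= 4 * (M%:R * (2 * s)) ->
  ((l / 32)%:E <= lambda (comb M `&` [set z : measurableTypeR R |
     (y - l <= (z : R) <= y + l)%R]))%E.
Proof.
move=> cy /andP[l0 lM].
have mC a b : measurable (comb M `&` [set z : measurableTypeR R | a <= (z : R) <= b]).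
  by apply: measurableI; [exact: measurable_comb|exact: measurable_cc].
have mC' a b : measurable (comb M `&` [set z : measurableTypeR R | a <= (z : R) < b]).
  by apply: measurableI; [exact: measurable_comb|exact: measurable_co].
have [k /= kM /andP[ky yk]] := cy.
(* A window longer than the comb gains nothing; the cap costs a factor of at most 4. *)
pose l' := Num.min l (M%:R * (2 * s)).
have l'l : l' <= l by rewrite ge_min lexx.
have l'M : l' <= M%:R * (2 * s) by rewrite ge_min lexx orbT.
have ll' : l / 4 <= l' by rewrite le_min; apply/andP; split; lra.
have [l's|sl'] := ltP l' (2 * s).
  have [a [b [ab c1 c2]]] : exists a b, [/\ l / 32 <= b - a,
      k%:R * (2 * s) <= a /\ b <= k%:R * (2 * s) + s & y - l <= a /\ b <= y + l].
    (* From [y], a step of l' / 4 < s / 2 towards the farther end stays in the tooth. *)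
    have [ym|my] := leP y (k%:R * (2 * s) + s / 2).
      by exists y, (y + l' / 4); split; [|split|split]; lra.
    by exists (y - l' / 4), y; split; [|split|split]; lra.
  apply: (@le_trans _ _ (lambda [set z : measurableTypeR R | a <= (z : R) <= b])).
    by rewrite lebesgue_measure_cc ?lee_fin//; lra.
  apply: le_measure; rewrite ?inE//; first exact: measurable_cc.
  move=> z /= /andP[az zb]; split; last by apply/andP; split; lra.
  by exists k => //=; apply/andP; split; lra.
pose q := l' / (2 * s).
have q1 : 1 <= q by rewrite ler_pdivlMr ?mul1r// mulr_gt0.
have qE : q * (2 * s) = l' by rewrite divfK// gt_eqF// mulr_gt0.
pose j := Num.trunc q.
have /andP[jq qj] : j%:R <= q < j.+1%:R by apply: truncn_itv; lra.
have j1 : (0 < j)%N by rewrite lt0n; apply/negP => /eqP j0; move: qj; rewrite j0; lra.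
have jM : (j <= M)%N.
  rewrite -(ler_nat R); apply: le_trans jq _.
  by rewrite ler_pdivrMr// mulr_gt0.
(* The run of [j] periods starts at tooth [k], or is shifted left just enough not to overrun the
   comb; either way it contains period [k]. *)
pose i := minn k (M - j).
have ik : (i <= k)%N by exact: geq_minl.
have ijM : (i + j <= M)%N.
  by rewrite -[leqRHS](subnK jM) leq_add2r geq_minr.
have kij : (k < i + j)%N.
  rewrite /i; case: (leqP k (M - j)) => _; last by rewrite subnK.
  by rewrite -addn1 leq_add2l.
have jb : j%:R * (2 * s) <= l' by rewrite -qE ler_wpM2r// mulr_ge0// ltW.
have bj : l' <= 2 * j%:R * (2 * s).
  rewrite -qE ler_wpM2r// ?mulr_ge0 ?ltW//.
  by apply: lt_le_trans qj _; rewrite -natrM ler_nat mul2n -addnn -addn1 leq_add2l.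
apply: (@le_trans _ _ (j%:R * s)%:E); first by rewrite lee_fin; lra.
apply: le_trans (lebesgue_comb_blocks ijM) _.
apply: le_measure; rewrite ?inE//.
move=> z /= [cz /andP[iz zij]]; split=> //.
have H1 : i%:R * (2 * s) <= k%:R * (2 * s).
  by rewrite ler_wpM2r ?ler_nat// mulr_ge0// ltW.
have H2 : (k%:R + 1) * (2 * s) <= (i%:R + j%:R) * (2 * s).
  by rewrite ler_wpM2r ?natr1 -?natrD ?ler_nat// mulr_ge0// ltW.
move: zij H2; rewrite natrD !mulrDl => zij H2.
by apply/andP; split; lra.
Qed.

End comb.


Section max_coordinate.
Context (R : realType) (d : nat).
Implicit Types x y : euclidean R d.

(** With base value 0 this is the sup-norm on the unit cube; it is nonnegative and 1-Lipschitz
    everywhere. *)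
Definition maxc x : R := \big[Num.max/0]_(i < d) (tnth x i : R).

Lemma le_maxc x i : (tnth x i : R) <= maxc x.
Proof. exact: le_bigmax. Qed.

Lemma maxc_ge0 x : 0 <= maxc x.
Proof. exact: bigmax_ge_id. Qed.

Lemma maxc_le x (a : R) : 0 <= a -> (forall i, (tnth x i : R) <= a) -> maxc x <= a.
Proof. by move=> a0 xa; apply: bigmax_le. Qed.

Lemma maxc_lipschitz x y : `|maxc x - maxc y| <= edist x y.
Proof.
wlog suff H : / forall x y, maxc x <= maxc y + edist x y.
  have := H x y; have := H y x.
  have -> : edist y x = edist x y.
    by rewrite /edist; congr Num.sqrt; apply: eq_bigr => i _; rewrite -sqrrN opprB.
  by rewrite ler_norml => ? ?; apply/andP; split; lra.
move=> {}x {}y; apply: maxc_le => [|i]; first by rewrite addr_ge0 ?maxc_ge0 ?edist_ge0.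
have := le_maxc y i; have := le_trans (ler_norm _) (dist_tnth x y i); lra.
Qed.

Lemma measurable_maxc : measurable_fun setT maxc.
Proof.
rewrite /maxc; elim: (index_enum _) => [|i r IH].
  by under eq_fun do rewrite big_nil; exact: measurable_cst.
under eq_fun do rewrite big_cons; apply: measurable_maxr => //.
exact: measurable_tnth.
Qed.

Lemma measurable_maxc_le (a : R) : measurable [set x | maxc x <= a].
Proof.
rewrite (_ : [set _ | _] = maxc @^-1` [set` `]-oo, a]]).
  by rewrite -[X in measurable X]setTI; apply: measurable_maxc => //; exact: measurable_itv.
by apply/seteqP; split=> x; rewrite /= in_itv.
Qed.

Lemma measurable_maxc_ge (a : R) : measurable [set x | a <= maxc x].
Proof.
rewrite (_ : [set _ | _] = maxc @^-1` [set` `[a, +oo[]).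
  by rewrite -[X in measurable X]setTI; apply: measurable_maxc => //; exact: measurable_itv.
by apply/seteqP; split=> x; rewrite /= in_itv/= andbT.
Qed.

End max_coordinate.

(** * The domain: cells and outer part, closedness and local thickness *)

Section domain.
Context (R : realType) (d : nat) (s : R) (M : nat).
Local Notation D := (M%:R * (2 * s)).
Hypotheses (d0 : (0 < d)%N) (s0 : 0 < s) (D8 : 8 * D <= 1).
Local Notation lambda := (@lebesgue_measure R).
Implicit Types (x y : euclidean R d) (k j : {ffun 'I_d -> 'I_M}).

Definition grid_cell k : set (euclidean R d) := box (fun i => tooth s (k i)).
Definition cells : set (euclidean R d) := box (fun=> comb s M).
(** The threshold is twice the extent of the cells, so that [maxc] of a point of [outer] is at most
    twice its distance to any cell; [holder_reg] relies on this. *)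
Definition outer : set (euclidean R d) :=
  [set x | unit_cube x /\ 2 * D <= maxc x].
Definition domain := cells `|` outer.

Let D0 : 0 <= D.
Proof. by rewrite mulr_ge0// mulr_ge0// ltW. Qed.

Lemma cellsE : cells = \bigcup_k grid_cell k.
Proof.
apply/seteqP; split=> x.
  move=> cx.
  have tx i : exists k : 'I_M, tooth s k (tnth x i).
    by have [k /= kM tk] := cx i; exists (Ordinal kM).
  have [k kP] := choice tx.
  by exists [ffun i => k i] => // i; rewrite ffunE.
by move=> [k _ kx] i; exists (k i) => //=.
Qed.

Lemma grid_cell_sub k : grid_cell k `<=` cells.
Proof. by move=> x kx; rewrite cellsE; exists k. Qed.

Lemma grid_cell_far j k x y : j != k -> grid_cell j x -> grid_cell k y ->
  s <= edist x y.
Proof.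
move=> jk jx ky; have /existsP[i jki] : [exists i, j i != k i].
  by rewrite -negb_forall; apply: contraNN jk => /forallP jk; apply/eqP/ffunP => i; exact/eqP.
apply: le_trans (dist_tnth x y i).
exact: (tooth_far s0 jki (jx i) (ky i)).
Qed.

Lemma trivIset_grid_cell : trivIset setT grid_cell.
Proof.
move=> j k _ _ [x [jx kx]]; apply/eqP; apply: contraT => jk.
have := grid_cell_far jk jx kx.
rewrite /edist big1 ?sqrtr0 => [|i _]; last by rewrite subrr expr0n.
by rewrite leNgt s0.
Qed.

Lemma cells_maxc x : cells x -> maxc x <= D.
Proof. by move=> cx; apply: maxc_le => // i; case/andP: (comb_bound s0 (cx i)). Qed.

Lemma cells_outer x : cells x -> outer x -> (0 < M)%N -> False.
Proof.
move=> /cells_maxc xD [_ Dx] M0; have := le_trans Dx xD.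
have : 0 < D by rewrite mulr_gt0 ?ltr0n// mulr_gt0.
lra.
Qed.

Lemma cells_unit_cube : cells `<=` unit_cube.
Proof.
move=> x cx i; have /andP[x0 xD] := comb_bound s0 (cx i).
by apply/andP; split=> //; move: D8 D0; lra.
Qed.

Lemma domain_unit_cube : domain `<=` unit_cube.
Proof. by move=> x [/cells_unit_cube//|[]]. Qed.

Lemma unit_cubeE : unit_cube = box (fun=> [set y | 0 <= (y : R) <= 1]) :> set (euclidean R d).
Proof. by []. Qed.

Lemma maxc_le1 x : unit_cube x -> maxc x <= 1.
Proof. by move=> cx; apply: maxc_le => // i; case/andP: (cx i). Qed.

Lemma measurable_unit_cube : measurable (unit_cube : set (euclidean R d)).
Proof. by rewrite unit_cubeE; apply: measurable_box => i; exact: measurable_cc. Qed.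

Lemma measurable_cells : measurable cells.
Proof. by apply: measurable_box => i; exact: measurable_comb. Qed.

Lemma measurable_grid_cell k : measurable (grid_cell k).
Proof. by apply: measurable_box => i; exact: measurable_tooth. Qed.

Lemma measurable_outer : measurable outer.
Proof.
by apply: measurableI; [exact: measurable_unit_cube|exact: measurable_maxc_ge].
Qed.

Lemma measurable_domain : measurable domain.
Proof. by apply: measurableU; [exact: measurable_cells|exact: measurable_outer]. Qed.

Lemma lebesgue_grid_cell k : lebesgue (grid_cell k) = (s ^+ d)%:E.
Proof. exact: lebesgue_cube (ltW s0). Qed.

Lemma lebesgue_maxc_le (a : R) : 0 <= a ->
  (lebesgue (unit_cube `&` [set x : euclidean R d | (maxc x <= a)%R]) <= (a ^+ d)%:E)%E.
Proof.
move=> a0; rewrite -(lebesgue_cube (fun=> 0) a0); apply: le_measure; rewrite ?inE.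
- by apply: measurableI; [exact: measurable_unit_cube|exact: measurable_maxc_le].
- by apply: measurable_box => i; exact: measurable_cc.
move=> x /= [cx xa] i; have /andP[xi0 _] := cx i.
by rewrite /= add0r xi0; exact: le_trans (le_maxc x i) xa.
Qed.

Lemma lebesgue_domain_le1 : (lebesgue domain <= 1)%E.
Proof.
have := lebesgue_maxc_le ler01; rewrite expr1n; apply: le_trans.
apply: le_measure; rewrite ?inE.
- exact: measurable_domain.
- by apply: measurableI; [exact: measurable_unit_cube|exact: measurable_maxc_le].
move=> x /domain_unit_cube cx; split=> //; exact: maxc_le1.
Qed.

(** The slab of the cube where the first coordinate is at least 2 D lies in [outer], and 2 D <=
    1/4. *)
Lemma lebesgue_domain_ge : ((2^-1)%:E <= lebesgue domain)%E.
Proof.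
pose a (i : 'I_d) : R := if (i : nat) == 0%N then 2 * D else 0.
pose A (i : 'I_d) := [set y : measurableTypeR R | a i <= (y : R) <= 1].
have mA i : measurable (A i) by exact: measurable_cc.
have D2 : 2 * D <= 1 by move: D8 D0; lra.
have a01 i : 0 <= a i <= 1.
  by rewrite /a; case: ifP => _; rewrite ?lexx ?ler01// D2 mulr_ge0.
apply: (@le_trans _ _ (lebesgue (box A))); last first.
  apply: le_measure; rewrite ?inE; [exact: measurable_box|exact: measurable_domain|].
  move=> x Ax; right; split.
    move=> i; have /andP[ax x1] := Ax i; rewrite x1 andbT.
    by apply: le_trans ax; case/andP: (a01 i).
  apply: le_trans (le_maxc x (Ordinal d0)).
  by have /andP[+ _] := Ax (Ordinal d0); rewrite /a eqxx.
rewrite lebesgue_box// (bigD1 (Ordinal d0))//= big1 ?mule1; last first.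
  move=> i i0; rewrite /A /a ifN; last by apply: contraNN i0 => /eqP i0; apply/eqP/val_inj.
  by rewrite lebesgue_measure_cc// subr0.
rewrite /A /a eqxx lebesgue_measure_cc// lee_fin; move: D8; lra.
Qed.

(** Inside a box the measure factorises, which reduces regularity to the line. Around a point of
    [outer] the box is a cube of side l turned inwards; around a point of a cell it is a product of
    comb windows while l <= 4 D, and beyond that the cube [l/2, l]^d, which lies in [outer] since
    l/2 > 2 D. *)
Lemma domain_box x (l : R) : domain x -> 0 < l <= 4^-1 ->
  exists A : 'I_d -> set (measurableTypeR R), [/\ forall i, measurable (A i),
    box A `<=` domain,
    forall i (y : R), A i y -> `|(tnth x i : R) - y| <= l &
    forall i, ((l / 32)%:E <= lambda (A i))%E].
Proof.
move=> [cx|[cx Dx]] /andP[l0 l4]; last first.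
  pose a i : R := if (tnth x i : R) <= 2^-1 then tnth x i else (tnth x i : R) - l.
  have aP i : 0 <= a i /\ a i + l <= 1.
    move: (cx i); rewrite /a; move: (tnth x i : R) => v /andP[v0 v1].
    by case: (leP v 2^-1) => v2; split; lra.
  exists (fun i => [set y | a i <= (y : R) <= a i + l]); split.
  - by move=> i; exact: measurable_cc.
  - move=> y Ay; right; split.
      by move=> i; have /andP[? ?] := Ay i; have [? ?] := aP i; apply/andP; split; lra.
    (* The coordinate attaining the maximum keeps the box in [outer]: it moves up, or it was above
       1/2 and stays above 1/2 - l >= 1/4 >= 2 D. *)
    have [i _ xi] : {i | i \in predT & maxc x = tnth x i}.
      by apply: (eq_bigmax (Ordinal d0)) => // i _; case/andP: (cx i).
    apply: le_trans (le_maxc y i); have /andP[+ _] := Ay i.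
    move: Dx D8 D0; rewrite xi /a; move: (tnth x i : R) => v.
    by case: (leP v 2^-1); lra.
  - by move=> i y /andP[]; rewrite /a ler_norml; case: ifP => _ ? ?; apply/andP; split; lra.
  - by move=> i; rewrite lebesgue_measure_cc ?lee_fin; lra.
have [lD|Dl] := leP l (4 * D).
  exists (fun i => comb s M `&` [set z | (tnth x i : R) - l <= (z : R) <= (tnth x i : R) + l]).
  split.
  - by move=> i; apply: measurableI; [exact: measurable_comb|exact: measurable_cc].
  - by move=> y Ay; left=> i; case: (Ay i).
  - by move=> i y [_ /andP[? ?]]; rewrite ler_norml; apply/andP; split; lra.
  - by move=> i; apply: (lebesgue_comb_near s0 (cx i)); rewrite l0.
exists (fun=> [set y | l / 2 <= (y : R) <= l]); split.
- by move=> i; exact: measurable_cc.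
- move=> y Ay; right; split.
    by move=> i; have /andP[? ?] := Ay i; apply/andP; split; lra.
  apply: le_trans (le_maxc y (Ordinal d0)).
  by have /andP[? ?] := Ay (Ordinal d0); lra.
- move=> i y /andP[? ?]; have /andP[? ?] := comb_bound s0 (cx i).
  by rewrite ler_norml; apply/andP; split; lra.
- by move=> i; rewrite lebesgue_measure_cc ?lee_fin; lra.
Qed.

Lemma lebesgue_domain_eball x (l r : R) : domain x -> 0 < l <= 4^-1 -> d%:R * l < r ->
  (((l / 32) ^+ d)%:E <= lebesgue (domain `&` eball x r))%E.
Proof.
move=> xO /andP[l0 l4] lr; have [|A [mA AO Al lA]] := domain_box (l := l) xO.
  by rewrite l0.
have r0 : 0 < r by apply: le_lt_trans lr; rewrite mulr_ge0// ltW.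
apply: (@le_trans _ _ (lebesgue (box A))).
  by rewrite lebesgue_box//; apply: le_prode_const => //; rewrite divr_ge0// ltW.
apply: le_measure; rewrite ?inE; first exact: measurable_box.
  by apply: measurableI; [exact: measurable_domain|exact: measurable_eball].
move=> y Ay; split; first exact: AO.
by apply: edist_lt lr _ => // i; apply: Al; exact: Ay.
Qed.

Lemma domain_closed x : ~ domain x ->
  exists2 r : R, 0 < r & forall y, domain y -> r <= edist x y.
Proof.
move=> nO; have nc : ~ cells x by move=> c; apply: nO; left.
have no : ~ outer x by move=> c; apply: nO; right.
have [r r0 rc] : exists2 r : R, 0 < r & forall y, cells y -> r <= edist x y.
  have [i nci] : exists i, ~ comb s M (tnth x i) by exact/existsNP.
  have [r r0 rP] := comb_closed nci.
  exists r => // y cy; rewrite leNgt; apply/negP => xyr.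
  by apply: (rP (tnth y i)) => //; exact: le_lt_trans (dist_tnth x y i) xyr.
have [r' r'0 ro] : exists2 r : R, 0 < r & forall y, outer y -> r <= edist x y.
  have [cx|/existsNP[i nci]] := pselect (unit_cube x).
    have Dx : maxc x < 2 * D by rewrite ltNge; apply/negP => Dx; apply: no.
    exists (2 * D - maxc x); rewrite ?subr_gt0// => y [_ Dy].
    have := maxc_lipschitz x y; rewrite ler_norml => /andP[? ?]; lra.
  have [xi0|xi0] := ltP (tnth x i : R) 0.
    exists (- (tnth x i : R)); rewrite ?oppr_gt0// => y [cy _].
    have := dist_tnth x y i; have /andP[? ?] := cy i.
    by rewrite ler_norml => /andP[? ?]; lra.
  have [xi1|xi1] := ltP 1 (tnth x i : R).
    exists ((tnth x i : R) - 1); rewrite ?subr_gt0// => y [cy _].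
    have := dist_tnth x y i; have /andP[? ?] := cy i.
    by rewrite ler_norml => /andP[? ?]; lra.
  by exfalso; apply: nci; rewrite xi0 xi1.
exists (Num.min r r'); first by rewrite lt_min r0.
by move=> y [cy|oy]; rewrite ge_min; [rewrite rc|rewrite ro// orbT].
Qed.

End domain.


(** * The regression functions *)

(** By homogeneity u = 1 up to the factor u^e <= u^b. With w = v / u, Bernoulli's inequality gives 1
    - w^e <= 1 - w^(K+1) <= (K+1) (1 - w) <= (K+1) (1 - w)^b. The integer [K] is there to have a
    natural exponent. *)
Lemma powR_holder (R : realType) (u v e b : R) (K : nat) :
  0 <= u <= 1 -> 0 <= v <= 1 -> 0 <= b <= e -> b <= 1 -> e <= K%:R ->
  `|u `^ e - v `^ e| <= K.+1%:R * `|u - v| `^ b.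
Proof.
move=> u01 v01 be b1 eK; wlog vu : u v u01 v01 / v <= u.
  move=> H; have [vu|/ltW uv] := leP v u; first exact: H.
  by rewrite distrC [`|u - v|]distrC; exact: H.
move: u01 v01 be => /andP[u0 u1] /andP[v0 v1] /andP[b0 be].
have e0 : 0 <= e by exact: le_trans be.
rewrite ger0_norm; last by rewrite subr_ge0 ge0_ler_powR ?nnegrE.
rewrite ger0_norm ?subr_ge0//.
have [->|nvu] := eqVneq v u.
  by rewrite subrr mulr_ge0// powR_ge0.
have {nvu} vu' : v < u by rewrite lt_neqAle nvu.
have u0' : 0 < u by exact: le_lt_trans v0 vu'.
pose w := v / u.
have w0 : 0 <= w by rewrite divr_ge0.
have w1 : w < 1 by rewrite ltr_pdivrMr// mul1r.
have vE : v = u * w by rewrite mulrC divfK// gt_eqF.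
have wK : w ^+ K.+1 <= w `^ e.
  move: w0; rewrite le_eqVlt => /orP[/eqP <-|w0].
    by rewrite expr0n/= powR_ge0.
  rewrite -powR_mulrn ?(ltW w0)// ger_powR ?w0 ?(ltW w1)//.
  by apply: le_trans eK _; rewrite ler_nat.
have we : 1 - w `^ e <= K.+1%:R * (1 - w) `^ b.
  have := @bernoulli_ineq R (1 - w) K.+1; rewrite subr_ge0 (ltW w1) gerBl w0 => /(_ isT).
  have : K.+1%:R * (1 - w) <= K.+1%:R * (1 - w) `^ b.
    by rewrite ler_wpM2l// ger1_powR// subr_gt0 w1/= gerBl.
  have -> : 1 - (1 - w) = w by ring.
  by move: wK; lra.
rewrite vE powRM// -{1}[u `^ e]mulr1 -mulrBr -{2}[u]mulr1 -mulrBr.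
have w1' : 0 <= 1 - w by rewrite subr_ge0 ltW.
rewrite (powRM _ u0 w1') mulrCA.
apply: ler_pM => //; rewrite ?powR_ge0//.
- rewrite subr_ge0; apply: le_trans (_ : 1 `^ e <= 1); last by rewrite powR1.
  by rewrite ge0_ler_powR ?nnegrE// ltW.
- by rewrite ger_powR ?u0'.
Qed.

Section regression_function.
Context (R : realType) (d : nat) (s : R) (M : nat).
Local Notation D := (M%:R * (2 * s)).
Hypotheses (d0 : (0 < d)%N) (M0 : (0 < M)%N) (s0 : 0 < s) (D8 : 8 * D <= 1).
Local Notation I := {ffun 'I_d -> 'I_M}.
Local Notation cell := (@grid_cell R d s M).
Local Notation outer := (@outer R d s M).
Local Notation domain := (@domain R d s M).
Implicit Types (x y : euclidean R d) (k j : I) (sg : {ffun I -> bool}) (c e : R).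

(** One formula serves both distributions, with [(cq, e)] for eta_Q and [(cp, g * e)] for eta_P. As
    a finite sum of terms with indicators it is measurable term by term. *)
Definition reg c e sg x : R :=
  2^-1 + \1_outer x * (c * maxc x `^ e) +
  \sum_k \1_(cell k) x * (if sg k then c * s `^ e else - (c * s `^ e)).

Let sD : 2 * s <= D.
Proof. by rewrite ler_peMl ?ler1n// mulr_ge0// ltW. Qed.

Let s1 : s <= 1. Proof. by move: sD D8 s0; lra. Qed.

Lemma reg_cell c e sg k x : cell k x ->
  reg c e sg x = 2^-1 + (if sg k then c * s `^ e else - (c * s `^ e)).
Proof.
move=> kx; rewrite /reg [X in X * (c * _)]indicE memNset; last first.
  by move=> ox; exact: (cells_outer s0 (grid_cell_sub kx) ox M0).
rewrite mul0r addr0 (bigD1 k)//= indicE mem_set// mul1r big1 ?addr0// => j jk.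
rewrite indicE memNset ?mul0r// => jx; move/eqP: jk; apply.
by apply: (trivIset_grid_cell s0 (M := M)) => //; exists x.
Qed.

Lemma reg_outer c e sg x : outer x -> reg c e sg x = 2^-1 + c * maxc x `^ e.
Proof.
move=> ox; rewrite /reg [X in X * (c * _)]indicE mem_set// mul1r big1 ?addr0// => k _.
rewrite indicE memNset ?mul0r// => kx.
exact: (cells_outer s0 (grid_cell_sub kx) ox M0).
Qed.

Lemma reg_notin c e sg x : ~ domain x -> reg c e sg x = 2^-1.
Proof.
move=> nx; rewrite /reg indicE memNset; last by move=> ox; apply: nx; right.
rewrite mul0r addr0 big1 ?addr0// => k _.
rewrite indicE memNset ?mul0r// => kx; apply: nx; left; exact: grid_cell_sub kx.
Qed.

Variant domain_spec x : Prop :=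
| InCell k of cell k x
| InOuter of outer x & 2 * D <= maxc x & maxc x <= 1
| NotIn of ~ domain x.

Lemma domainP x : domain_spec x.
Proof.
have [[cx|ox]|nx] := pselect (domain x); last exact: NotIn.
  by move: cx; rewrite cellsE => -[k _ kx]; exact: (InCell kx).
by apply: InOuter => //; case: ox => // cx _; exact: maxc_le1.
Qed.

Lemma measurable_reg c e sg : measurable_fun setT (reg c e sg).
Proof.
apply: measurable_funD.
  apply: measurable_funD => //; apply: measurable_funM.
    by apply: measurable_indic; exact: measurable_outer.
  apply: measurable_funM => //.
  by apply: (measurableT_comp (measurable_powR e)); exact: measurable_maxc.
apply: measurable_sum => k; apply: measurable_funM => //.
by apply: measurable_indic; exact: measurable_grid_cell.
Qed.

Lemma powR_le1 (a e : R) : 0 <= a <= 1 -> 0 <= e -> 0 <= a `^ e <= 1.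
Proof.
move=> /andP[a0 a1] e0; rewrite powR_ge0/=.
apply: le_trans (_ : 1 `^ e <= 1); last by rewrite powR1.
by rewrite ge0_ler_powR ?nnegrE.
Qed.

Lemma reg01 c e sg x : 0 <= c <= 2^-1 -> 0 <= e -> 0 <= reg c e sg x <= 1.
Proof.
move=> /andP[c0 c2] e0.
have bnd (a : R) : 0 <= a <= 1 -> 0 <= c * a `^ e <= 2^-1.
  move=> a01; have /andP[p0 p1] := powR_le1 a01 e0; rewrite mulr_ge0//=.
  by apply: le_trans (ler_wpM2l c0 p1) _; rewrite mulr1.
have /andP[? ?] : 0 <= c * s `^ e <= 2^-1 by apply: bnd; rewrite ltW.
case: (domainP x) => [k kx|ox _ x1|nx].
- by rewrite (reg_cell _ _ _ kx); case: ifP => _; apply/andP; split; lra.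
- have /andP[? ?] : 0 <= c * maxc x `^ e <= 2^-1 by apply: bnd; rewrite maxc_ge0.
  by rewrite reg_outer//; apply/andP; split; lra.
- by rewrite reg_notin//; apply/andP; split; lra.
Qed.

Lemma holder_reg c e b C (K : nat) sg : 0 <= c -> 0 <= b <= e -> b <= 1 -> e <= K%:R ->
  4 * c <= C -> c * K.+1%:R <= C -> holder C b domain (reg c e sg).
Proof.
move=> c0 /andP[b0 be] b1 eK cC cK.
have C0 : 0 <= C by apply: le_trans cC; rewrite mulr_ge0.
have e0 : 0 <= e by exact: le_trans be.
(* Here c a^e <= c a^b <= c (2 t)^b <= 2 c t^b, which explains the condition 4 c <= C. *)
have near a (t : R) : 0 < a <= 1 -> a <= 2 * t -> c * a `^ e <= C / 2 * t `^ b.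
  move=> /andP[a0 a1] at2.
  have t0 : 0 <= t by move: a0 at2; lra.
  have : a `^ e <= 2 * t `^ b.
    apply: (@le_trans _ _ (a `^ b)); first by rewrite ger_powR ?a0.
    apply: (@le_trans _ _ ((2 * t) `^ b)).
      by rewrite ge0_ler_powR ?nnegrE ?mulr_ge0// ltW.
    rewrite powRM// ler_wpM2r ?powR_ge0//.
    by rewrite -[leRHS](powRr1 (ler0n R 2)) ler_powR// ler1n.
  have p0 := powR_ge0 t b.
  move=> /(ler_wpM2l c0) /le_trans; apply.
  have := ler_wpM2r p0 cC; lra.
have sym x y : edist x y = edist y x.
  by rewrite /edist; congr Num.sqrt; apply: eq_bigr => i _; rewrite -sqrrN opprB.
have cs0 : 0 <= c * s `^ e by rewrite mulr_ge0// powR_ge0.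
have co x y k : cell k x -> outer y -> 2 * D <= maxc y -> maxc y <= 1 ->
    `|reg c e sg x - reg c e sg y| <= C * edist x y `^ b.
  move=> kx oy Dy y1; rewrite (reg_cell _ _ _ kx) reg_outer//.
  have xD := cells_maxc s0 (grid_cell_sub kx).
  have := maxc_lipschitz x y; rewrite ler_norml => /andP[xy _].
  have y0 : 0 < maxc y by apply: lt_le_trans Dy; move: s0 sD; lra.
  have : c * maxc y `^ e <= C / 2 * edist x y `^ b.
    by apply: near; rewrite ?y0//; move: xy xD Dy sD s0; lra.
  have : c * s `^ e <= C / 2 * edist x y `^ b.
    apply: near; rewrite ?s0//; move: xy xD Dy sD s0; lra.
  have : 0 <= c * maxc y `^ e by rewrite mulr_ge0// powR_ge0.
  by rewrite ler_norml; case: ifP => _ ? ? ?; apply/andP; split; lra.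
move=> x y xO yO; case: (domainP x) => [k kx|ox Dx x1|//]; case: (domainP y) => [j jy|oy Dy y1|//].
- rewrite (reg_cell _ _ _ kx) (reg_cell _ _ _ jy).
  have [<-|kj] := eqVneq k j; first by rewrite subrr normr0 mulr_ge0// powR_ge0.
  have : c * s `^ e <= C / 2 * edist x y `^ b.
    by apply: near; rewrite ?s0//; have := grid_cell_far s0 kj kx jy; move: s0; lra.
  by rewrite ler_norml; case: ifP => _; case: ifP => _ ?; apply/andP; split; lra.
- exact: co kx oy Dy y1.
- by rewrite distrC sym; exact: co jy ox Dx x1.
- rewrite !reg_outer// opprD addrACA subrr add0r -mulrBr normrM (ger0_norm c0).
  have : `|maxc x `^ e - maxc y `^ e| <= K.+1%:R * `|maxc x - maxc y| `^ b.
    by apply: powR_holder; rewrite ?maxc_ge0 ?b0.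
  move=> /(ler_wpM2l c0) /le_trans; apply.
  rewrite mulrA; apply: ler_pM; rewrite ?mulr_ge0 ?powR_ge0//.
  by rewrite ge0_ler_powR ?nnegrE ?edist_ge0//; exact: maxc_lipschitz.
Qed.

(** On each piece both deviations are powers of the same quantity and carry the same sign; with
    exponents e and g e only the constants remain to be compared. *)
Lemma relative_signal_reg c c' e g C sg : 0 <= c -> 0 <= c' -> 0 <= C -> 
  C * c `^ g <= c' ->
  relative_signal C g domain (reg c' (g * e) sg) (reg c e sg).
Proof.
move=> c0 c'0 C0 cc' x xO.
have H (a : R) : 0 <= a -> C * (c * a `^ e) `^ g <= c' * a `^ (g * e).
  move=> a0; rewrite powRM ?powR_ge0// -powRrM [e * g]mulrC mulrA.
  by rewrite ler_wpM2r// powR_ge0.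
have p (a e' c1 : R) : 0 <= c1 -> 0 <= c1 * a `^ e' by move=> ?; rewrite mulr_ge0// powR_ge0.
case: (domainP x) => [k kx|ox _ _|//].
  rewrite !(reg_cell _ _ _ kx) ![2^-1 + _]addrC !addrK.
  have Hs := H s (ltW s0); have p1 := p s (g * e) _ c'0; have p2 := p s e _ c0.
  move: Hs p1 p2; set A := c' * _; set B := c * _ => HAB A0 B0.
  by case: ifP => _; [|rewrite mulrNN !normrN]; rewrite !ger0_norm//; split=> //;
    exact: mulr_ge0.
rewrite !reg_outer// ![2^-1 + _]addrC !addrK !ger0_norm ?p//.
by split; [rewrite mulr_ge0 ?p|exact/H/maxc_ge0].
Qed.

End regression_function.


(** * Laws with uniform marginal on the domain, and the conditions of the class *)

Section uniform_law.
Context (R : realType) (d : nat) (s : R) (M : nat).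
Local Notation D := (M%:R * (2 * s)).
Hypotheses (d0 : (0 < d)%N) (M0 : (0 < M)%N) (s0 : 0 < s) (D8 : 8 * D <= 1).
Local Notation domain := (@domain R d s M).
Local Notation I := {ffun 'I_d -> 'I_M}.

Definition volume : R := fine (lebesgue domain).

Lemma volumeE : lebesgue domain = volume%:E.
Proof.
rewrite /volume fineK// ge0_fin_numE//.
exact: le_lt_trans (lebesgue_domain_le1 d s0 D8) (ltry _).
Qed.

Lemma volume_bounds : 2^-1 <= volume <= 1.
Proof.
by rewrite -2!lee_fin -volumeE lebesgue_domain_ge// lebesgue_domain_le1.
Qed.

Let V0 : 0 < volume. Proof. by case/andP: volume_bounds; lra. Qed.

Definition unif_density (x : euclidean R d) : R := \1_domain x * volume^-1.

Lemma measurable_unif_density : measurable_fun setT unif_density.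
Proof.
apply: measurable_funM => //; apply: measurable_indic; exact: measurable_domain.
Qed.

Lemma unif_density_ge0 x : 0 <= unif_density x.
Proof. by rewrite mulr_ge0// invr_ge0 ltW. Qed.

Definition unif : set (euclidean R d) -> \bar R :=
  mdensity lebesgue measurable_unif_density unif_density_ge0.

HB.instance Definition _ := Measure.on unif.

Lemma unifE A : measurable A ->
  unif A = (volume^-1%:E * lebesgue (domain `&` A))%E.
Proof.
move=> mA; have mO := @measurable_domain R d s M.
rewrite /unif /mdensity /unif_density.
under eq_integral do rewrite mulrC EFinM.
rewrite ge0_integralZl_EFin ?invr_ge0 ?(ltW V0)//.
- by rewrite integral_indic.
- exact/measurable_funTS/measurable_EFinP/measurable_indic.
Qed.

Let unif_setT : unif setT = 1%E.
Proof. by rewrite unifE// setIT volumeE -EFinM mulVf// gt_eqF. Qed.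

HB.instance Definition _ := Measure_isProbability.Build _ _ _ unif unif_setT.

Lemma unif_le A : measurable A -> (unif A <= 2%:E * lebesgue (domain `&` A))%E.
Proof.
move=> mA; rewrite unifE//; apply: lee_wpmul2r; first exact: measure_ge0.
rewrite lee_fin -[leRHS]invrK lef_pV2 ?posrE ?invr_gt0//.
by case/andP: volume_bounds.
Qed.

Lemma unif_sub A : measurable A -> A `<=` domain ->
  unif A = (volume^-1%:E * lebesgue A)%E.
Proof. by move=> mA AO; rewrite unifE// setIidr. Qed.

Section law_of_regression.
Variable eta : euclidean R d -> R.
Hypotheses (meta : measurable_fun setT eta) (eta01 : forall x, 0 <= eta x <= 1).

Local Notation J := (joint_distribution unif meta eta01).

Lemma marginal_joint A : measurable A -> marginal J A = unif A.
Proof.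
move=> mA; apply: etrans (joint_distribution_setX unif meta eta01 mA).
by rewrite /marginal /pushforward; congr (J _); apply/seteqP; split=> -[x b] //= [].
Qed.

Let J_cube : J (unit_cube `*` setT) = 1%E.
Proof.
have mc := @measurable_unit_cube R d.
transitivity (unif unit_cube); first exact: joint_distribution_setX.
rewrite unifE// setIidl ?volumeE; last exact: domain_unit_cube.
by rewrite -EFinM mulVf// gt_eqF.
Qed.

Let J_regression : is_regression J eta.
Proof.
split=> // A mA; apply: etrans (joint_distribution_true unif meta eta01 mA) _.
apply/esym/(@eq_measure_integral _ _ _ _ unif
  (measure_function_pushforward__canonical__measure_function_Measure J measurable_fst)).
by move=> B mB _; exact: marginal_joint.
Qed.

Definition law_of_regression : law R d := Law J_cube J_regression.

Lemma marginal_law A : measurable A -> marginal law_of_regression A = unif A.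
Proof. exact: marginal_joint. Qed.

(** One inclusion is closedness of the domain, the other its local thickness
    [lebesgue_domain_eball]. *)
Lemma support_law : support (marginal law_of_regression) = domain.
Proof.
apply/seteqP; split=> x.
  move=> sx; have [//|nx] := pselect (domain x).
  have [r r0 xr] := domain_closed nx.
  have mb := measurable_eball x r0.
  have := sx r r0; rewrite marginal_law// unifE//.
  rewrite (_ : domain `&` _ = set0) ?measure0 ?mule0 ?ltxx//.
  by apply/seteqP; split=> y // -[/xr]; rewrite /eball/= leNgt => /negP.
move=> xO r r0; have mb := measurable_eball x r0.
rewrite marginal_law// unifE// mule_gt0 ?lte_fin ?invr_gt0//.
pose l := Num.min 4^-1 (r / (2 * d%:R)).
have dR0 : 0 < d%:R :> R by rewrite ltr0n.
have l0 : 0 < l by rewrite lt_min invr_gt0 ltr0n/= divr_gt0// mulr_gt0.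
have l4 : l <= 4^-1 by rewrite ge_min lexx.
have lr : d%:R * l < r.
  have : l <= r / (2 * d%:R) by rewrite ge_min lexx orbT.
  rewrite ler_pdivlMr ?mulr_gt0// => H; move: r0; lra.
apply: lt_le_trans (lebesgue_domain_eball d0 s0 D8 xO _ lr); last by rewrite l0.
by rewrite lte_fin exprn_gt0// divr_gt0.
Qed.

Lemma strong_density_law c : 0 < c <= 4^-1 -> strong_density c domain law_of_regression.
Proof.
move=> /andP[c0 c4]; exists unif_density.
  split; [exact: measurable_unif_density|exact: unif_density_ge0|].
  by move=> A mA; rewrite marginal_law.
move=> x xO; rewrite /unif_density indicE mem_set// mul1r.
have /andP[V2 V1] := volume_bounds; apply/andP; split.
  apply: (@lt_le_trans _ _ 1); first by lra.
  by rewrite invf_ge1.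
by rewrite ltf_pV2 ?posrE//; lra.
Qed.

End law_of_regression.

(** The box side is l = r / (4 d max(r0, 1)), a fixed fraction of r that satisfies d l < r and l <=
    1/4 for all r < r0. The ball is bounded by its circumscribed cube of side 2 r, and l / 32 is the
    stated constant times 2 r. *)
Lemma regular_domain (c r0 : R) :
  0 < c <= (((4 * d%:R * Num.max r0 1)^-1) / 64) ^+ d -> regular_set c r0 domain.
Proof.
move=> /andP[c0 cr] x r xO /andP[r_gt0 rr0].
set m := Num.max r0 1; set c1 := (4 * d%:R * m)^-1.
have dR1 : 1 <= d%:R :> R by rewrite ler1n.
have m1 : 1 <= m by rewrite le_max lexx orbT.
have rm : r < m by apply: lt_le_trans rr0 _; rewrite le_max lexx.
have dm : 0 < 4 * d%:R * m by rewrite !mulr_gt0//; lra.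
pose l := c1 * r.
have lE : (4 * d%:R * m) * l = r by rewrite mulVKf// gt_eqF.
have l0 : 0 < l by rewrite mulr_gt0// invr_gt0.
have dl : d%:R * l < r.
  have dl0 : 0 < d%:R * l by rewrite mulr_gt0//; lra.
  have : 4 * (d%:R * l) * 1 <= 4 * (d%:R * l) * m by rewrite ler_wpM2l//; lra.
  move: lE dl0; lra.
have l4 : l <= 4^-1.
  have : m * l * 1 <= m * l * d%:R.
    by rewrite ler_wpM2l// mulr_ge0 ?(ltW l0)//; lra.
  have : m * (4 * l) <= m * 1 -> 4 * l <= 1 by rewrite ler_pM2l//; lra.
  move: lE rm; lra.
apply: (@le_trans _ _ (c%:E * ((2 * r) ^+ d)%:E)%E).
  by apply: lee_wpmul2l; [rewrite lee_fin ltW|exact: lebesgue_eball_le].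
apply: le_trans (lebesgue_domain_eball d0 s0 D8 xO _ dl); last by rewrite l0.
rewrite -EFinM lee_fin (_ : l / 32 = c1 / 64 * (2 * r)); last by rewrite /l; field.
by rewrite [leRHS]exprMn ler_wpM2r// exprn_ge0// mulr_ge0// ltW.
Qed.

Lemma law_of_reg01 c e (sg : {ffun I -> bool}) : 0 <= c <= 2^-1 -> 0 <= e ->
  forall x : euclidean R d, 0 <= reg s c e sg x <= 1.
Proof. by move=> c2 e0 x; exact: reg01. Qed.

Definition reg_law c e (sg : {ffun I -> bool}) (c2 : 0 <= c <= 2^-1) (e0 : 0 <= e) :=
  law_of_regression (measurable_reg s c e sg) (law_of_reg01 sg c2 e0).

(** Let y solve c y^e = t. If y <= s, no point of the domain is that close to 1/2. Otherwise the
    noise set lies in the cells and in the part where [maxc] is below y, of total mass at most 2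
    (D^d + min(1, y)^d). Both terms are of order y^(a e) = (t / c)^a: the first by the bound on D^d
    and s < y, the second because a e <= d. *)
Lemma tsybakov_reg_law c e (sg : {ffun I -> bool}) (c2 : 0 <= c <= 2^-1)
    (e0 : 0 <= e) (a K Ca : R) :
  0 < c -> 0 < e -> 0 <= a -> a * e <= d%:R -> 0 <= K ->
  D ^+ d <= K * s `^ (a * e) -> 2 * (K + 1) * c^-1 `^ a <= Ca ->
  tsybakov_noise Ca a (reg_law sg c2 e0).
Proof.
move=> c0 e_gt0 a0 aed K0 DK KCa t /andP[t0 t2].
set B := [set x | _].
have mB : measurable B.
  rewrite (_ : B = reg s c e sg @^-1` [set` `]2^-1 - t, 2^-1 + t[]).
    by rewrite -[X in measurable X]setTI; apply: measurable_reg => //; exact: measurable_itv.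
  by apply/seteqP; split=> x; rewrite /B/= in_itv/= ltr_norml => /andP[? ?];
    apply/andP; split; lra.
rewrite marginal_law//; apply: le_trans (unif_le mB) _.
pose y := (t / c) `^ e^-1.
have tc0 : 0 < t / c by rewrite divr_gt0.
have y0 : 0 < y by rewrite powR_gt0.
have ye : y `^ e = t / c by rewrite -powRrM mulVf ?gt_eqF// powRr1// ltW.
have tE : t = c * y `^ e by rewrite ye mulrC divfK// gt_eqF.
have yae : y `^ (a * e) = c^-1 `^ a * t `^ a.
  by rewrite mulrC powRrM ye -powRM ?invr_ge0 ?(ltW c0) ?(ltW t0)// mulrC.
have lty (z : R) : 0 <= z -> `|2^-1 + c * z `^ e - 2^-1| < t -> z < y.
  move=> z0; rewrite [2^-1 + _]addrC addrK ger0_norm ?mulr_ge0 ?powR_ge0 ?(ltW c0)//.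
  rewrite tE ltr_pM2l// => zy; rewrite ltNge; apply/negP => yz.
  by move: zy; rewrite ltNge ge0_ler_powR ?nnegrE// ltW.
have cellB k x : grid_cell s (M := M) k x -> B x -> s < y.
  move=> kx; rewrite /B/= (reg_cell M0 s0 _ _ _ kx)// => H; apply: lty; first exact: ltW.
  by move: H; case: ifP => _ //; rewrite ![2^-1 + _]addrC !addrK normrN.
have outerB x : outer s M x -> B x -> maxc x < y.
  by move=> ox; rewrite /B/= reg_outer// => H; apply: lty H; exact: maxc_ge0.
have RHS0 : 0 <= Ca * t `^ a.
  rewrite mulr_ge0 ?powR_ge0//; apply: le_trans KCa.
  by rewrite mulr_ge0 ?powR_ge0// mulr_ge0// addr_ge0.
have [ys|sy] := leP y s.
  rewrite (_ : domain `&` B = set0) ?measure0 ?mule0 ?lee_fin//.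
  apply/seteqP; split=> x // -[xO Bx]; case: (domainP s M x) => [k kx|ox Dx _|//].
    by have := cellB _ _ kx Bx; rewrite ltNge ys.
  have := outerB _ ox Bx; have : s <= M%:R * s by rewrite ler_peMl ?ler1n// ltW.
  by move: s0; lra.
(* The cap at 1 allows lowering the exponent from d to a e. *)
have min0 : 0 < Num.min 1 y by rewrite lt_min ltr01.
apply: (@le_trans _ _ (2%:E * ((D ^+ d)%:E + (Num.min 1 y ^+ d)%:E))%E).
  apply: lee_wpmul2l => //.
  pose S b := unit_cube `&` [set x : euclidean R d | maxc x <= b].
  have mS b : measurable (S b).
    by apply: measurableI; [exact: measurable_unit_cube|exact: measurable_maxc_le].
  apply: (@le_trans _ _ (lebesgue (S D `|` S (Num.min 1 y)))).
    apply: le_measure; rewrite ?inE; [|exact: measurableU|].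
      by apply: measurableI => //; exact: measurable_domain.
    move=> x [xO Bx]; have cx := domain_unit_cube s0 D8 xO.
    case: (domainP s M x) => [k kx|ox _ x1|//].
      by left; split=> //=; apply: cells_maxc => //; exact: grid_cell_sub kx.
    right; split=> //=; rewrite le_min x1/=.
    exact/ltW/outerB.
  apply: le_trans (measureU2 _ _ _) _ => //.
  by apply: leeD; apply: lebesgue_maxc_le; [rewrite !mulr_ge0// ltW|exact: ltW].
rewrite -EFinD -EFinM lee_fin.
have h1 : D ^+ d <= K * y `^ (a * e).
  apply: le_trans DK _; rewrite ler_wpM2l// ge0_ler_powR ?nnegrE ?mulr_ge0// ltW//.
have h2 : Num.min 1 y ^+ d <= y `^ (a * e).
  rewrite -powR_mulrn ?(ltW min0)//.
  apply: (@le_trans _ _ (Num.min 1 y `^ (a * e))).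
    by rewrite ger_powR// min0 ge_min lexx.
  by rewrite ge0_ler_powR ?nnegrE ?mulr_ge0 ?(ltW y0) ?(ltW min0)// ge_min lexx orbT.
apply: le_trans (ler_wpM2r (powR_ge0 t a) KCa).
rewrite -[leRHS]mulrA -yae; lra.
Qed.

End uniform_law.


(** * The lower bound at a fixed scale s and resolution M *)

Section minimax_at_scale.
Context (R : realType) (d : nat) (s : R) (M : nat).
Local Notation D := (M%:R * (2 * s)).
Hypotheses (d0 : (0 < d)%N) (M0 : (0 < M)%N) (s0 : 0 < s) (D8 : 8 * D <= 1).
Variables (a bP bQ g c_lam r_lam Cb Ca Cg e cp cq K : R) (N : nat).
Hypotheses (a0 : 0 <= a) (g0 : 0 < g) (e0 : 0 < e) (Cg0 : 0 < Cg) (aed : a * e <= d%:R).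
Hypotheses (bP01 : 0 <= bP <= 1) (bQ01 : 0 <= bQ <= 1) (bPe : bP <= g * e) (bQe : bQ <= e)
  (geN : g * e <= N%:R) (eN : e <= N%:R).
Hypotheses (cp0 : 0 <= cp <= 2^-1) (cq0 : 0 < cq <= 2^-1)
  (cp4 : 4 * cp <= Cb) (cpN : cp * N.+1%:R <= Cb)
  (cq4 : 4 * cq <= Cb) (cqN : cq * N.+1%:R <= Cb) (cpq : Cg * cq `^ g <= cp).
Hypotheses (c_lam4 : 0 < c_lam <= 4^-1)
  (c_lamr : c_lam <= (((4 * d%:R * Num.max r_lam 1)^-1) / 64) ^+ d).
Hypotheses (K0 : 0 <= K) (DK : D ^+ d <= K * s `^ (a * e))
  (KCa : 2 * (K + 1) * cq^-1 `^ a <= Ca).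
Local Notation theta := (Params a bP bQ g c_lam r_lam Cb Ca Cg).

Let ge0 : 0 <= g * e. Proof. by rewrite mulr_ge0 ?ltW. Qed.
Let cq2 : 0 <= cq <= 2^-1. Proof. by case/andP: cq0 => ? ->; rewrite ltW. Qed.

Let lawP sg := reg_law d0 M0 s0 D8 sg cp0 ge0.
Let lawQ sg := reg_law d0 M0 s0 D8 sg cq2 (ltW e0).

Lemma reg_law_in_class sg : transfer_class theta (lawP sg, lawQ sg).
Proof.
exists (@domain R d s M); split.
- by split; [exact: domain_unit_cube|rewrite support_law|rewrite support_law].
- split; [|exact: strong_density_law|exact: strong_density_law].
  by apply: regular_domain => //; case/andP: c_lam4 => -> _.
- case/andP: bP01 => ? ?; case/andP: bQ01 => ? ?.
  case/andP: cp0 => ? ?; case/andP: cq2 => ? ?.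
  split.
    by apply: (@holder_reg R d s M M0 s0 D8 cp (g * e) bP Cb N sg) => //; exact/andP.
  by apply: (@holder_reg R d s M M0 s0 D8 cq e bQ Cb N sg) => //; exact/andP.
- by case/andP: cq0 => ? ?; exact: (@tsybakov_reg_law R d s M d0 M0 s0 D8 cq e sg cq2 (ltW e0) a K Ca).
- case/andP: cp0 => ? ?; case/andP: cq2 => ? ?.
  by apply: (@relative_signal_reg R d s M M0 s0 cq cp e g Cg sg) => //; exact: ltW.
Qed.

(** This is [assouad] with M^d cells of mass s^d / V. Since 1 <= 1 / V <= 2, the upper bound turns
    the 4 of [assouad] into the 8 of the hypothesis, and the lower bound removes V from the
    conclusion. *)
Lemma minimax_ge n :
  n%:R * (8 * cp ^+ 2 * (s `^ (g * e)) ^+ 2 * s ^+ d) <= 2^-1 ->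
  ((cq * s `^ e * (M%:R * s) ^+ d / 4)%:E <= minimax_excess_risk d n theta)%E.
Proof.
move=> small; apply/ereal_infP => _ [fhat mfhat <-].
have /andP[V2 V1] := volume_bounds d0 s0 D8.
set V := volume _ _ _ in V2 V1.
have V0 : 0 < V by apply: lt_le_trans V2.
have sd0 : 0 < s ^+ d by rewrite exprn_gt0.
have iV2 : V^-1 <= 2 by rewrite -[leRHS]invrK lef_pV2 ?posrE ?invr_gt0.
have iV1 : 1 <= V^-1 by rewrite invf_ge1.
have sP := powR_ge0 s (g * e).
have sP1 : s `^ (g * e) <= 1.
  have s1 : s <= 1.
    have : s <= M%:R * s by rewrite ler_peMl ?ler1n// ltW.
    by move: D8 s0; lra.
  have s01 : 0 <= s <= 1 by rewrite s1 ltW.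
  by have /andP[] := powR_le1 s01 ge0.
have muC (k : {ffun 'I_d -> 'I_M}) :
    unif d0 s0 D8 (grid_cell s k) = (V^-1 * s ^+ d)%:E.
  rewrite unif_sub//; last 2 first.
  - exact: measurable_grid_cell.
  - by move=> x kx; left; exact: grid_cell_sub kx.
  by rewrite (lebesgue_grid_cell s0) -EFinM.
have hP01 : 0 <= cp * s `^ (g * e) <= 2^-1.
  case/andP: cp0 => cp0' cp2; rewrite mulr_ge0//=.
  by apply: le_trans (ler_wpM2l cp0' sP1) _; rewrite mulr1.
have hQ0 : 0 <= cq * s `^ e.
  by rewrite mulr_ge0 ?powR_ge0//; case/andP: cq2.
have := assouad (@measurable_grid_cell R d s M) (trivIset_grid_cell s0 (M := M))
  _ muC hP01 hQ0 (fun sg => measurable_reg s cp (g * e) sg) (fun sg => measurable_reg s cq e sg)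
  (fun sg => law_of_reg01 M0 s0 D8 sg cp0 ge0) (fun sg => law_of_reg01 M0 s0 D8 sg cq2 (ltW e0))
  _ _ _ mfhat.
case; last move=> sg sgP.
- by rewrite mulr_gt0// invr_gt0.
- by move=> sg k x kx; exact: reg_cell.
- by move=> sg k x kx; exact: reg_cell.
- move=> sg k x nkx; case: (domainP s M x) => [j jx|ox _ _|nx].
  + have jk : (j == k) = false by apply/eqP => jk; apply: nkx; rewrite -jk.
    by rewrite !(reg_cell M0 s0 _ _ _ jx) ffunE jk.
  + by rewrite !reg_outer.
  + by rewrite !reg_notin.
- apply: le_trans small; rewrite ler_wpM2l// exprMn.
  have : V^-1 * (cp ^+ 2 * s `^ (g * e) ^+ 2 * s ^+ d) <= 2 * (cp ^+ 2 * s `^ (g * e) ^+ 2 * s ^+ d).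
    rewrite ler_wpM2r//; apply: mulr_ge0; last exact: ltW.
    by rewrite mulr_ge0// sqr_ge0.
  lra.
apply: le_trans (ereal_sup_ubound _); last first.
  by exists (lawP sg, lawQ sg); [exact: reg_law_in_class|reflexivity].
rewrite /excess_risk leeBrDr; last first.
  rewrite /risk; apply: fin_num_measure; apply: measurable_misclassified.
  by apply: measurable_fun_ler => //; exact: measurable_reg.
apply: le_trans sgP; rewrite addeC; apply: leeD => //.
rewrite lee_fin card_ffun !card_ord natrX exprMn.
have : cq * s `^ e * s ^+ d * M%:R ^+ d * 1 <= cq * s `^ e * s ^+ d * M%:R ^+ d * V^-1.
  rewrite ler_wpM2l//; apply: mulr_ge0; last exact: exprn_ge0.
  by apply: mulr_ge0 => //; exact: ltW.
lra.
Qed.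

End minimax_at_scale.


(** * The rate *)

Section scale.
Context (R : realType) (d : nat) (q s : R).
Hypotheses (d0 : (0 < d)%N) (q01 : 0 <= q <= 1) (s_gt0 : 0 < s) (s32 : s <= 32^-1).

(** With q = a e / d this makes M s of order s^q, that is (M s)^d of order s^(a e), the mass that
    the noise condition tolerates. The factor 1/32 and s <= 1/32 give 16 M s <= 16 (1/32 + 1/32) =
    1, so the cells fit; the successor keeps M positive. *)
Definition resolution : nat := (Num.trunc (s `^ (q - 1) / 32)).+1.

Lemma resolution_bounds :
  s `^ q / 32 <= resolution%:R * s <= s `^ q / 32 + s.
Proof.
have y0 : 0 <= s `^ (q - 1) / 32 by rewrite divr_ge0 ?powR_ge0.
have sy : s `^ (q - 1) * s = s `^ q.
  rewrite -{2}[s](powRr1 (ltW s_gt0)) -powRD ?subrK//.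
  by apply/implyP => _; rewrite gt_eqF.
have /andP[my ym] := truncn_itv y0.
have h1 := ler_wpM2r (ltW s_gt0) my; have h2 := ler_wpM2r (ltW s_gt0) (ltW ym).
have yE : s `^ (q - 1) / 32 * s = s `^ q / 32 by rewrite mulrAC sy.
have rE : resolution%:R = (Num.trunc (s `^ (q - 1) / 32))%:R + 1 :> R.
  by rewrite /resolution -natr1.
rewrite yE in h1; rewrite yE -/resolution rE in h2.
by rewrite rE; apply/andP; split; lra.
Qed.

Lemma resolution_fits : 8 * (resolution%:R * (2 * s)) <= 1.
Proof.
have /andP[_] := resolution_bounds.
have sq : s `^ q <= 1.
  have s01 : 0 <= s <= 1 by move: s_gt0 s32 => ? ?; apply/andP; split; lra.
  by case/andP: q01 => q0 _; have /andP[] := powR_le1 s01 q0.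
move: s32; lra.
Qed.

Let sq_s : s <= s `^ q.
Proof.
case/andP: q01 => q0 q1; rewrite -[leLHS](powRr1 (ltW s_gt0)).
by rewrite ger_powR// s_gt0/=; move: s32; lra.
Qed.

Let sqd : (s `^ q) ^+ d = s `^ (q * d%:R).
Proof. by rewrite -powR_mulrn ?powR_ge0// -powRrM. Qed.

Lemma resolution_upper : (resolution%:R * (2 * s)) ^+ d <= 4 ^+ d * s `^ (q * d%:R).
Proof.
rewrite -sqd -exprMn; apply: lerXn2r; rewrite ?nnegrE.
- by rewrite !mulr_ge0// ltW.
- by rewrite mulr_ge0// powR_ge0.
have /andP[_] := resolution_bounds; have := sq_s; have := powR_ge0 s q; lra.
Qed.

Lemma resolution_lower : 32^-1 ^+ d * s `^ (q * d%:R) <= (resolution%:R * s) ^+ d.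
Proof.
rewrite -sqd -exprMn; apply: lerXn2r; rewrite ?nnegrE.
- by rewrite mulr_ge0// powR_ge0.
- by rewrite mulr_ge0// ltW.
by have /andP[+ _] := resolution_bounds; lra.
Qed.

End scale.

(** The bound 1/4 leaves room for a density between 1 and 2; the other one is the constant of
    [regular_domain]. *)
Definition density_bound (R : realType) (d : nat) (r_lam : R) : R :=
  Num.min 4^-1 (((4 * d%:R * Num.max r_lam 1)^-1 / 64) ^+ d).

Lemma density_bound_gt0 (R : realType) (d : nat) (r_lam : R) : (0 < d)%N ->
  0 < density_bound d r_lam.
Proof.
move=> d0; rewrite lt_min invr_gt0 ltr0n/= exprn_gt0// divr_gt0// invr_gt0.
by rewrite !mulr_gt0 ?ltr0n// lt_max ltr01 orbT.
Qed.

Lemma minimax_rate (R : realType) (d : nat) (r_lam a bP bQ g Cb Cg e : R) :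
  (0 < d)%N -> 0 <= a -> 0 < g -> 0 < e -> 0 < Cb -> 0 < Cg -> a * e <= d%:R ->
  0 <= bP <= 1 -> 0 <= bQ <= 1 -> bP <= g * e -> bQ <= e ->
  exists2 C0 : R, 0 < C0 & forall c_lam Ca : R,
    0 < c_lam <= density_bound d r_lam -> C0 <= Ca ->
  exists2 c : R, 0 < c & forall n : nat, (0 < n)%N ->
    ((c * n%:R `^ (- ((1 + a) * e / (2 * (g * e) + d%:R))))%:E <=
     minimax_excess_risk d n (Params a bP bQ g c_lam r_lam Cb Ca Cg))%E.
Proof.
move=> d0 a0 g0 e0 Cb0 Cg0 aed bP01 bQ01 bPe bQe.
have ge0 : 0 < g * e by rewrite mulr_gt0.
have dR0 : 0 < d%:R :> R by rewrite ltr0n.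
pose N := (Num.trunc (g * e + e)).+1.
have N_ge : g * e + e <= N%:R.
  by have /andP[_ /ltW] : (Num.trunc (g * e + e))%:R <= g * e + e < N%:R
    by apply: truncn_itv; lra.
have N0 : 0 <= N%:R :> R by [].
(* N + 5 dominates both factors 4 and N + 1 of [holder_reg]. *)
pose cp := Num.min 4^-1 (Cb / (N%:R + 5)).
have cp0 : 0 < cp by rewrite lt_min invr_gt0 ltr0n/= divr_gt0//; lra.
have cp4 : cp <= 4^-1 by rewrite ge_min lexx.
have cpC : cp * (N%:R + 5) <= Cb.
  by rewrite -ler_pdivlMr ?ge_min ?lexx ?orbT//; lra.
have cpN : 0 <= cp * N%:R by rewrite mulr_ge0 ?ltW.
(* The second term solves Cg x^g = cp, the relative signal with equality. *)
pose cq := Num.min cp ((cp / Cg) `^ g^-1).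
have cpg : 0 < cp / Cg by rewrite divr_gt0.
have cq0 : 0 < cq by rewrite lt_min cp0 powR_gt0.
have cqp : cq <= cp by rewrite ge_min lexx.
have cqN : cq * N%:R <= cp * N%:R by rewrite ler_wpM2r.
have cqg : Cg * cq `^ g <= cp.
  rewrite mulrC -ler_pdivlMr//.
  have -> : cp / Cg = ((cp / Cg) `^ g^-1) `^ g.
    by rewrite -powRrM mulVf ?gt_eqF// powRr1// ltW.
  by rewrite ge0_ler_powR ?nnegrE ?powR_ge0 ?(ltW g0) ?(ltW cq0)// ge_min lexx orbT.
(* This is the noise constant of [tsybakov_reg_law] with K = 4^d, taken from [resolution_upper]. *)
pose C0 : R := 2 * (4 ^+ d + 1) * cq^-1 `^ a.
have p4 : 0 <= 4 ^+ d :> R by rewrite exprn_ge0.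
exists C0; first by rewrite /C0 mulr_gt0 ?powR_gt0 ?invr_gt0//; lra.
move=> c_lam Ca /andP[c_lam0]; rewrite le_min => /andP[c_lam4 c_lamr] C0Ca.
pose w := 2 * (g * e) + d%:R.
have w0 : 0 < w by rewrite /w; lra.
pose q := a * e / d%:R.
have qd : q * d%:R = a * e by rewrite divfK// gt_eqF.
have q01 : 0 <= q <= 1.
  by rewrite divr_ge0 ?mulr_ge0 ?(ltW e0)//= ler_pdivrMr// mul1r.
pose ex := (1 + a) * e.
(* The three factors come from [minimax_ge], from M s >= s^q / 32, and from s = r / 32. *)
exists (cq / 4 * 32^-1 ^+ d * 32^-1 `^ ex).
  by rewrite !mulr_gt0 ?exprn_gt0 ?powR_gt0 ?invr_gt0.
move=> n n0; have nR : 1 <= n%:R :> R by rewrite ler1n.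
have nR0 : 0 < n%:R :> R by rewrite ltr0n.
(* This r satisfies n r^w = 1; the scale is r / 32, so that [resolution_fits] applies to every n >=
   1. *)
pose r : R := n%:R `^ (- w^-1).
have r0 : 0 < r by rewrite powR_gt0.
have r1 : r <= 1.
  by rewrite /r -[leRHS](powRr0 (n%:R : R)) ler_powR// oppr_le0 invr_ge0 ltW.
have rw : r `^ w = n%:R^-1.
  by rewrite /r -powRrM mulNr mulVf ?gt_eqF// powR_inv1// ltW.
pose s := 32^-1 * r.
have s0 : 0 < s by rewrite mulr_gt0// invr_gt0.
have s32 : s <= 32^-1 by rewrite /s ler_piMr.
have sr : s <= r by rewrite /s; lra.
pose M := resolution q s.
have M0 : (0 < M)%N by [].
have D8 : 8 * (M%:R * (2 * s)) <= 1 by exact: resolution_fits.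
have DK : (M%:R * (2 * s)) ^+ d <= 4 ^+ d * s `^ (a * e).
  by rewrite -qd; exact: resolution_upper.
have sMd : 32^-1 ^+ d * s `^ (a * e) <= (M%:R * s) ^+ d.
  by rewrite -qd; exact: resolution_lower.
(* The powers of s combine into s^w with n s^w <= 1, and 8 cp^2 <= 8 / 16 = 1/2. *)
have small : n%:R * (8 * cp ^+ 2 * (s `^ (g * e)) ^+ 2 * s ^+ d) <= 2^-1.
  have sw : (s `^ (g * e)) ^+ 2 * s ^+ d = s `^ w.
    rewrite -!powR_mulrn ?powR_ge0 ?(ltW s0)// -powRrM -powRD.
      by rewrite [g * e * _]mulrC.
    by apply/implyP => _; rewrite gt_eqF.
  have swn : n%:R * s `^ w <= 1.
    have : s `^ w <= r `^ w.
      by rewrite ge0_ler_powR ?nnegrE ?(ltW w0) ?(ltW s0) ?(ltW r0).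
    rewrite rw => /(ler_wpM2l (ltW nR0)); rewrite divff// gt_eqF//.
  have cp2 : cp ^+ 2 <= 16^-1.
    rewrite expr2; apply: le_trans (ler_pM (ltW cp0) (ltW cp0) cp4 cp4) _; lra.
  have -> : n%:R * (8 * cp ^+ 2 * s `^ (g * e) ^+ 2 * s ^+ d) =
      8 * (cp ^+ 2 * (n%:R * s `^ w)) by rewrite -sw; ring.
  have := ler_pM (sqr_ge0 cp) (mulr_ge0 (ltW nR0) (powR_ge0 s w)) cp2 swn.
  lra.
have cp02 : 0 <= cp <= 2^-1 by apply/andP; split; lra.
have cq02 : 0 < cq <= 2^-1 by apply/andP; split; lra.
have nS : N.+1%:R = N%:R + 1 :> R by rewrite natr1.
apply: le_trans (_ : (cq * s `^ e * (M%:R * s) ^+ d / 4)%:E <= _)%E; last first.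
  apply: (@minimax_ge R d s M d0 M0 s0 D8 a bP bQ g c_lam r_lam Cb Ca Cg e cp cq (4 ^+ d) N) => //.
  - by move: N_ge ge0 e0; lra.
  - by move: N_ge ge0 e0; lra.
  - by move: cpC; lra.
  - by rewrite nS; move: cpC; lra.
  - by move: cpC; lra.
  - by rewrite nS; move: cpC; lra.
  - by rewrite c_lam0.
rewrite lee_fin.
have -> : n%:R `^ (- ((1 + a) * e / (2 * (g * e) + d%:R))) = r `^ ex.
  by rewrite /r -powRrM -/w -/ex mulNr [w^-1 * _]mulrC.
have sex : 32^-1 `^ ex * r `^ ex = s `^ e * s `^ (a * e).
  rewrite -powRM ?invr_ge0 ?(ltW r0)// -/s -powRD; last first.
    by apply/implyP => _; rewrite gt_eqF.
  by rewrite /ex mulrDl mul1r.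
rewrite -[leLHS]mulrA sex.
have := ler_wpM2l (mulr_ge0 (ltW cq0) (powR_ge0 s e)) sMd; lra.
Qed.


(** The thresholds restrict [theta] to classes that contain the construction: for c_lam >= 1, for
    instance, no density fits between c_lam and its inverse and the class is empty. [c0] depends on
    d and r_lam only, and [C0] is chosen before c_lam. Part (a) is [minimax_rate] with e = bP / g,
    part (b) with e = bQ. *)
Theorem theorem2 (R : realType) (d : nat) (d_gt0 : (0 < d)%N) (r_lam : R) :
  exists2 c0 : R, 0 < c0 &
  forall a bP bQ g C_b C_g : R,
  exists2 C0 : R, 0 < C0 &
  forall c_lam C_a : R, c_lam <= c0 -> C0 <= C_a ->
  let theta := Params a bP bQ g c_lam r_lam C_b C_a C_g in
  valid_params theta ->
  exists2 c : R, 0 < c &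
    (bP > g * bQ -> a * bP <= g * d%:R ->
     forall n : nat, (0 < n)%N ->
       ((c * n%:R `^ (- ((1 + a) * bP / (g * (2 * bP + d%:R)))))%:E
          <= minimax_excess_risk d n theta)%E) /\
    (bP <= g * bQ -> a * bQ <= d%:R ->
     forall n : nat, (0 < n)%N ->
       ((c * n%:R `^ (- ((1 + a) * bQ / (2 * g * bQ + d%:R))))%:E
          <= minimax_excess_risk d n theta)%E).
Proof.
exists (density_bound d r_lam); first exact: density_bound_gt0.
move=> a bP bQ g Cb Cg.
pose valid := [/\ 0 <= a, 0 < g, 0 < Cb & 0 < Cg] /\
  [/\ 0 <= bP <= 1, 0 <= bQ <= 1 & 0 < Num.max bP bQ].
have [vld|nvld] := pselect valid; last first.
  (* [C0] is chosen before validity is assumed; for invalid parameters the value 1 is a default. *)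
  exists 1 => // c_lam Ca _ _ theta; rewrite /valid_params /=.
  by move=> [[a0 bP01 bQ01 m0] [[g0 _ _] [Cb0 _ Cg0]]]; exfalso; exact: nvld.
have [[a0 g0 Cb0 Cg0] [bP01 bQ01 m0]] := vld.
have [/andP[bP0 _] /andP[bQ0 _]] := (bP01, bQ01).
have rate (e : R) (H : [/\ 0 < e, a * e <= d%:R, bP <= g * e & bQ <= e]) :=
  let: And4 e0 aed bPe bQe := H in
  minimax_rate r_lam d_gt0 a0 g0 e0 Cb0 Cg0 aed bP01 bQ01 bPe bQe.
have [bPQ|bPQ] := ltP (g * bQ) bP.
  have [aPd|aPd] := leP (a * bP) (g * d%:R); last first.
    (* Both parts are void here: the first by its side condition, the second by the comparison of bP
       and g bQ. *)
    by exists 1 => // *; exists 1 => //; split=> // _; rewrite leNgt aPd.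
  have bPgt0 : 0 < bP by apply: le_lt_trans bPQ; rewrite mulr_ge0// ltW.
  have geE : g * (bP / g) = bP by rewrite mulrC divfK// gt_eqF.
  have [|C0 C0gt0 rateC] := rate (bP / g).
    split; rewrite ?divr_gt0 ?geE//.
      by rewrite mulrA ler_pdivrMr// [leRHS]mulrC.
    by rewrite ler_pdivlMr// mulrC ltW.
  exists C0 => // c_lam Ca cl CC theta [_ [[_ c_lam0 _] _]].
  have [|c c0 cP] := rateC c_lam Ca _ CC; first by apply/andP.
  exists c => //; split=> // _ _ n n0.
  have -> : (1 + a) * bP / (g * (2 * bP + d%:R)) =
      (1 + a) * (bP / g) / (2 * (g * (bP / g)) + d%:R).
    by rewrite geE invfM !mulrA.
  exact: cP.
have [aQd|aQd] := leP (a * bQ) d%:R; last first.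
  by exists 1 => // *; exists 1 => //; split=> // _; rewrite leNgt aQd.
have bQgt0 : 0 < bQ.
  move: m0; rewrite lt_max => /orP[bPgt0|//].
  by rewrite -(pmulr_rgt0 _ g0); exact: lt_le_trans bPgt0 bPQ.
have [|C0 C0gt0 rateC] := rate bQ; first by split.
exists C0 => // c_lam Ca cl CC theta [_ [[_ c_lam0 _] _]].
have [|c c0 cP] := rateC c_lam Ca _ CC; first by apply/andP.
exists c => //; split=> // _ _ n n0.
by rewrite -[2 * g * bQ]mulrA; exact: cP.
Qed.
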